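(* Let $K$ be a number field and $c>0$. There is a constant $C>0$ depending only on $K$ and $c$ such that the following holds for every real $H\ge 1$. For $i\in\{1,2,3\}$ let $a_i,b_i,c_i\in K$ and $$A_i=\begin{pmatrix}1&a_i&c_i\\0&1&b_i\\0&0&1\end{pmatrix},$$ with $\mathcal{H}(A_i)\le cH$. If there are non-zero integers $k_1,k_2,k_3$ such that $$A_1^{k_1}A_2^{k_2}A_3^{k_3}=I_3,$$ then there are non-zero integers $k_1,k_2,k_3$ with $|k_1|,|k_2|,|k_3|\le C H^{58}$ such that $A_1^{k_1}A_2^{k_2}A_3^{k_3}=I_3$ holds.
   Context: For a matrix $A=(a_{ij})$ with algebraic entries, $\mathcal{H}(A)$ denotes the (absolute) multiplicative Weil height of $A$ viewed as a point of projective space via the tuple of its entries (here one of the entries is $1$). $I_3$ is the $3\times 3$ identity matrix. *)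

(* Defs.v *)
From HB Require Import structures.
From mathcomp Require Import all_boot all_order all_algebra all_field.
From mathcomp Require Import finmap complex.
From mathcomp Require Import all_classical all_reals all_analysis.

Set Implicit Arguments.
Unset Strict Implicit.
Unset Printing Implicit Defensive.
Import Order.TTheory GRing.Theory Num.Theory.

Local Open Scope classical_set_scope.
Local Open Scope ring_scope.

(* A number field is a finite extension of the rationals, [fieldExtType rat];
   its degree is [\dim {:K}]. *)

Section Places.
Variables (R : realType) (K : fieldExtType rat).

(* The archimedean places are listed as complex embeddings, so that a pair of
   conjugate embeddings accounts for the local degree 2 of a complex place. *)
Definition embeddings : set (K -> R[i]) :=
  [set s | zmod_morphism s /\ monoid_morphism s].

(* A finite place is given by its normalised discrete valuation, of value group
   exactly the integers.  The valuation of 0, conventionally infinite, is set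
   to 0 so that distinct functions are distinct places. *)
Definition finite_places : set (K -> int) :=
  [set v | [/\ v 0 = 0,
    forall x y : K, x != 0 -> y != 0 -> v (x * y) = v x + v y,
    forall x y : K, x != 0 -> y != 0 -> x + y != 0 ->
      Num.min (v x) (v y) <= v (x + y) &
    exists2 x : K, x != 0 & v x = 1]].

Definition valuation_ring (v : K -> int) : set K :=
  [set x | x = 0 \/ 0 <= v x].

Definition valuation_ideal (v : K -> int) : set K :=
  [set x | x = 0 \/ 0 < v x].

Definition residue_field (v : K -> int) : set (set K) :=
  [set [set y | valuation_ideal v (y - x)] | x in valuation_ring v].

(* The residue fields of a number field are finite. *)
Definition residue_card (v : K -> int) : nat := #|` fset_set (residue_field v)|.

(* This is |x|_v to the power of the local degree, where |.|_v extends the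
   usual p-adic absolute value of the rationals. *)
Definition finite_abs (v : K -> int) (x : K) : R :=
  if x == 0 then 0 else (residue_card v)%:R ^ (- v x).

Definition arch_abs (s : K -> R[i]) (x : K) : R := Normc.normc (s x).

Definition max_entry (m n : nat) (nu : K -> R) (A : 'M[K]_(m, n)) : R :=
  \big[Num.max/0]_(ij : 'I_m * 'I_n) nu (A ij.1 ij.2).

(* The products have finite support as soon as A is nonzero. *)
Definition relative_height (m n : nat) (A : 'M[K]_(m, n)) : R :=
  (\big[*%R/1]_(s \in embeddings) max_entry (arch_abs s) A) *
  (\big[*%R/1]_(v \in finite_places) max_entry (finite_abs v) A).

Definition weil_height (m n : nat) (A : 'M[K]_(m, n)) : R :=
  relative_height A `^ (\dim {:K})%:R^-1.

End Places.

Definition unitri3 (K : nzRingType) (a b c : K) : 'M[K]_3 :=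
  \matrix_(i < 3, j < 3)
    nth 0 (nth [::] [:: [:: 1; a; c];
                        [:: 0; 1; b];
                        [:: 0; 0; 1]] i) j.

(* Main.v *)
From HB Require Import structures.
Require Import Defs.
From mathcomp Require Import all_boot all_order all_algebra all_field.
From mathcomp Require Import finmap complex.
From mathcomp Require Import all_classical all_reals all_analysis.
From mathcomp Require Import zify ring lra.
Set Implicit Arguments.
Unset Strict Implicit.
Unset Printing Implicit Defensive.
Import Order.TTheory GRing.Theory Num.Theory.
Local Open Scope classical_set_scope.
Local Open Scope ring_scope.

(**
A relation A_0^k_0 A_1^k_1 A_2^k_2 = 1 in the Heisenberg group becomes, after
taking logarithms, the system k.a = 0, k.b = 0 and

  k.g + (k_0 k_1 w_2 - k_0 k_2 w_1 + k_1 k_2 w_0) = 0,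

where g_i = 2 c_i - a_i b_i and w is the cross product of a and b
([unitri3_prod_eq1]).  There are two cases.

If w <> 0, the first two equations make k proportional to w, and the third one
fixes the factor: k_i w_j w_l = - w.g for {i, j, l} = {0, 1, 2}.  So the given
exponents are determined by the matrices, and k_i is an integer that is a
quotient of two polynomials of bounded degree in the entries
([rigid_bound]).

If w = 0, the quadratic terms vanish and k solves a homogeneous linear system
over K.  Trace forms turn it into a system over the integers, in three unknowns
and with a solution without zero entries, and such a system has a small
solution without zero entries ([small_full_solution]): a cross product of two
rows if the rank is 2, and an explicit vector if it is smaller.

Both cases need the entries of each A_i to be controlled at every complex
embedding by the height of A_i, with an exponent that does not depend on K.
This is [small_denominator]: there is a nonzero common denominator delta of the
entries such that all conjugates of delta times the entries are at most a
constant times the height.  It is proved by the pigeonhole principle, applied to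
integer combinations of the powers of an integral primitive element; the cells
are boxes whose sides are weighted by the size of the entries at the embeddings,
cut further by the classes modulo the denominator ideal.  The number of these
classes is bounded by the product of the finite local heights, and the number of
boxes by the product of the archimedean ones.  After multiplication by the
product of the three denominators all entries are algebraic integers with
conjugates O(H^3), and both cases lead to exponents O(H^12), which is well
within O(H^58).

The places of K enter through four facts, which are proved here from the
definition of a normalised discrete valuation: residue fields are finite, an
element is a unit at almost all places, the valuation ring modulo the n-th power
of its maximal ideal has at most q^n elements, and there are enough places: an
element that is nonnegative at all of them is an algebraic integer
([ringint_integral]).  The last one rests on Chevalley's construction of
valuation rings, followed by a proof that such a ring of a number field is
discrete.  Algebraic integers are used only through the integrality of their
norms and traces, which are computed with the Vandermonde matrix of the
conjugates of the primitive element.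
*)

(** * Subgroups and prime ideals of the integers *)

(** The least positive element generates, by Euclidean division. The lemma
    serves both for the integers of positive valuation and for normalising a
    valuation, where J is its group of values. *)
Lemma int_subgroup (J : set int) : (forall m n, J m -> J n -> J (m - n)) ->
  (exists2 n, n != 0 & J n) ->
  exists2 g : nat, (0 < g)%N & forall n, J n <-> (g%:Z %| n)%Z.
Proof.
move=> JB [n0 n00 Jn0].
have J0 : J 0 by rewrite -(subrr n0); apply: JB.
have JN n : J n -> J (- n) by move=> h; rewrite -sub0r; apply: JB.
have JD m n : J m -> J n -> J (m + n) by move=> hm /JN /(JB _ _ hm); rewrite opprK.
have Jabs n : J n -> J `|n|%N.
  by case: n => n // /JN; rewrite NegzE opprK.
have ex : exists g : nat, `[< (0 < g)%N /\ J g >].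
  by exists `|n0|%N; apply/asboolP; split; [rewrite absz_gt0|exact: Jabs].
case: (ex_minnP ex) => g /asboolP [g0 Jg] gmin.
have JM (q : int) : J (q * g).
  have Jnat (k : nat) : J (k%:Z * g).
    elim: k => [|k IH]; first by rewrite mul0r.
    by rewrite intS mulrDl mul1r; apply: JD.
  by case: q => k //; rewrite NegzE mulNr; apply/JN/Jnat.
exists g => // n; split => [Jn|/dvdzP[q ->]]; last exact: JM.
apply/dvdz_mod0P/eqP; apply: contrapT => /negP r0.
have Jr : J (n %% g)%Z.
  have -> : (n %% g)%Z = n - (n %/ g)%Z * g by rewrite {2}(divz_eq n g); ring.
  exact: JB.
have r1 : 0 <= (n %% g)%Z by apply: modz_ge0; lia.
have r2 : (n %% g)%Z < g by apply: ltz_pmod; lia.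
suff /gmin : `[< (0 < `|(n %% g)%Z|)%N /\ J `|(n %% g)%Z|%N >] by lia.
by apply/asboolP; split; [rewrite absz_gt0|exact: Jabs].
Qed.

Lemma int_prime_ideal (J : set int) : (forall m n, J m -> J n -> J (m - n)) ->
  (exists2 n, n != 0 & J n) -> ~ J 1 -> (forall m n, J (m * n) -> J m \/ J n) ->
  exists2 p : nat, prime p & forall n, J n <-> (p%:Z %| n)%Z.
Proof.
move=> JB Jn J1 JP; have [p p0 hp] := int_subgroup JB Jn.
exists p => //; apply/primeP; split.
  suff : p != 1%N by lia.
  by apply/eqP => p1; apply/J1/hp; rewrite p1.
move=> d /dvdnP[e pe].
have [e0 d0] : (0 < e)%N /\ (0 < d)%N by apply/andP; rewrite -muln_gt0 -pe.
have /JP[] : J (e%:Z * d%:Z) by apply/hp; rewrite -PoszM -pe dvdzz.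
  move=> /hp /(dvdn_leq _) /= h; apply/orP; left; apply/eqP.
  by have := h e0; nia.
move=> /hp /(dvdn_leq _) /= h; apply/orP; right; apply/eqP.
by have := h d0; nia.
Qed.

(** * Counting by codes *)

Section Codes.
Variable T : Type.
Implicit Types (X : set T) (E : T -> T -> Prop).

(** A map with at most N values that separates X up to E. Counting the values
    of such maps replaces the index of a subgroup: no quotient is formed, and
    conditions at different places are combined by multiplying their numbers
    of values. *)
Definition has_code X (N : nat) E := exists f : T -> nat,
  (forall x, X x -> (f x < N)%N) /\ forall x y, X x -> X y -> f x = f y -> E x y.

Lemma sub_code X X' N E E' : X' `<=` X ->
  (forall x y, X' x -> X' y -> E x y -> E' x y) -> has_code X N E -> has_code X' N E'.
Proof.
move=> XX EE [f [f_lt fE]]; exists f; split=> [x hx|x y hx hy e].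
  by apply/f_lt/XX.
by apply: EE => //; apply: fE => //; apply: XX.
Qed.

Lemma code_and X N M E F : has_code X N E -> has_code X M F ->
  has_code X (N * M) (fun x y => E x y /\ F x y).
Proof.
move=> [f [f_lt fE]] [g [g_lt gF]]; exists (fun x => f x + N * g x)%N; split.
  by move=> x hx; have := f_lt x hx; have := g_lt x hx; nia.
move=> x y hx hy e.
have e1 : f x = f y.
  have := congr1 (modn^~ N) e.
  by rewrite /= ![(_ + _ * _)%N]addnC ![(N * _)%N]mulnC !modnMDl !modn_small ?f_lt.
split; first exact: fE.
apply: gF => //; move: e; rewrite e1 => /addnI /eqP; rewrite eqn_mul2l.
case/orP=> /eqP //; have := f_lt x hx; lia.
Qed.

Lemma code_all X (I : eqType) (s : seq I) (N : I -> nat) (E : I -> T -> T -> Prop) :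
  {in s, forall i, has_code X (N i) (E i)} ->
  has_code X (\prod_(i <- s) N i) (fun x y => {in s, forall i, E i x y}).
Proof.
elim: s => [|i s IH] hs.
  by rewrite big_nil; exists (fun=> 0%N).
rewrite big_cons; have hi := hs i (mem_head i s).
have {}IH := IH (fun j js => hs j (mem_behead (s := i :: s) js)).
apply: sub_code (code_and hi IH) => // x y _ _ [h1 h2] j.
by rewrite inE => /orP[/eqP -> //|]; apply: h2.
Qed.

Lemma code_pigeonhole X N E (S : finType) (P : S -> T) : has_code X N E ->
  (forall s, X (P s)) -> (N < #|S|)%N -> exists s s', s != s' /\ E (P s) (P s').
Proof.
move=> [f [f_lt fE]] XP NS; apply: contrapT => H.
pose g s : 'I_N := Ordinal (f_lt _ (XP s)).
have /leq_card : injective g.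
  move=> s s' /(congr1 val) /= e; apply/eqP; apply: contrapT => /negP ss'.
  by apply: H; exists s, s'; split => //; apply: fE.
by rewrite card_ord leqNgt NS.
Qed.

End Codes.

(** * Normalised valuations and integer relations *)

Section Valuation.
Variable K : fieldExtType rat.
Implicit Types (v : K -> int) (x y : K) (n m : int).

Lemma intr_fieldExt_eq0 n : (n%:~R == 0 :> K) = (n == 0).
Proof. by rewrite -(rmorph_int (in_alg K)) fmorph_eq0 intr_eq0. Qed.

(** The element 0 counts as having infinite valuation, although the valuation
    function is 0 there; with this reading the sets are additive subgroups. *)
Definition vge v n : set K := [set x | x = 0 \/ n <= v x].

Section OnePlace.
Variable v : K -> int.
Hypothesis hv : finite_places v.

Lemma placeM x y : x != 0 -> y != 0 -> v (x * y) = v x + v y.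
Proof. by case: hv => _ + _ _; apply. Qed.

Lemma place1 : v 1 = 0.
Proof.
have := placeM (oner_neq0 K) (oner_neq0 K).
by rewrite mulr1 -[LHS]addr0 => /addrI.
Qed.

Lemma placeV x : x != 0 -> v x^-1 = - v x.
Proof.
move=> x0; have := placeM x0 (invr_neq0 x0).
by rewrite divff // place1 => /eqP; rewrite eq_sym addrC addr_eq0 => /eqP.
Qed.

Lemma placeN x : v (- x) = v x.
Proof.
have [->|x0] := eqVneq x 0; first by rewrite oppr0.
have N1 : (-1 : K) != 0 by rewrite oppr_eq0 oner_eq0.
have : v (-1) + v (-1) = 0 by rewrite -(placeM N1 N1) mulrNN mulr1 place1.
move=> h; rewrite -mulN1r (placeM N1 x0).
have -> : v (-1) = 0 by lia.
by rewrite add0r.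
Qed.

Lemma placeX x (k : nat) : x != 0 -> v (x ^+ k) = v x * k%:Z.
Proof.
move=> x0; elim: k => [|k IH]; first by rewrite expr0 place1 mulr0.
by rewrite exprS placeM ?expf_neq0 // IH intS mulrDr mulr1.
Qed.

Lemma vge0 n : vge v n 0. Proof. by left. Qed.

Lemma vge_refl x : vge v (v x) x. Proof. by right. Qed.

Lemma vgeE n x : x != 0 -> vge v n x = (n <= v x).
Proof.
move=> x0; apply/propext; split; last by right.
by case=> // /eqP; rewrite (negPf x0).
Qed.

Lemma vge_le n m x : n <= m -> vge v m x -> vge v n x.
Proof. by move=> nm [->|h]; [left|right; exact: le_trans h]. Qed.

Lemma vgeD n x y : vge v n x -> vge v n y -> vge v n (x + y).
Proof.
move=> [->|hx]; first by rewrite add0r.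
move=> [->|hy]; first by rewrite addr0; right.
have [->|x0] := eqVneq x 0; first by rewrite add0r; right.
have [->|y0] := eqVneq y 0; first by rewrite addr0; right.
have [->|s0] := eqVneq (x + y) 0; first by left.
right; case: hv => _ _ /(_ _ _ x0 y0 s0) h _.
by apply: le_trans h; rewrite le_min hx hy.
Qed.

Lemma vgeN n x : vge v n x -> vge v n (- x).
Proof. by move=> [->|h]; [left; rewrite oppr0|right; rewrite placeN]. Qed.

Lemma vgeB n x y : vge v n x -> vge v n y -> vge v n (x - y).
Proof. by move=> hx /vgeN; apply: vgeD. Qed.

Lemma vgeM n m x y : vge v n x -> vge v m y -> vge v (n + m) (x * y).
Proof.
move=> [->|hx]; first by rewrite mul0r; left.
move=> [->|hy]; first by rewrite mulr0; left.
have [->|x0] := eqVneq x 0; first by rewrite mul0r; left.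
have [->|y0] := eqVneq y 0; first by rewrite mulr0; left.
by right; rewrite placeM // lerD.
Qed.

Lemma vge_sum n (I : Type) (r : seq I) (P : pred I) (F : I -> K) :
  (forall i, P i -> vge v n (F i)) -> vge v n (\sum_(i <- r | P i) F i).
Proof. by move=> h; apply: big_ind => //; [exact: vge0|exact: vgeD]. Qed.

Lemma vge1 : vge v 0 1.
Proof. by right; rewrite place1. Qed.

Lemma vge_int n : vge v 0 n%:~R.
Proof.
have nat_ge (k : nat) : vge v 0 k%:R.
  by elim: k => [|k IH]; [left|rewrite -natr1; apply: vgeD => //; exact: vge1].
case: n => n; first exact: nat_ge.
by rewrite NegzE mulrNz; apply/vgeN/nat_ge.
Qed.

(** If the sum vanished, y would have the same valuation as x. All statements
    below that some sum is nonzero come down to this. *)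
Lemma vge_dominant x y : x != 0 -> vge v (v x + 1) y -> x + y != 0.
Proof.
move=> x0 h; apply/negP => /eqP; rewrite addrC => /eqP.
rewrite addr_eq0 => /eqP yx.
have xy : x = - y by rewrite yx opprK.
have : vge v (v x + 1) (- y) by apply: vgeN.
by rewrite -xy vgeE //; lia.
Qed.

Lemma sum_dominant (I : finType) (F : I -> K) (i : I) : F i != 0 ->
  (forall j, j != i -> F j = 0 \/ v (F i) < v (F j)) -> \sum_j F j != 0.
Proof.
move=> Fi0 h; rewrite (bigD1 i) //=; apply: vge_dominant => //.
by apply: vge_sum => j /h []; [left|right; lia].
Qed.

End OnePlace.

(** More elements than the degree are linearly dependent over the rationals,
    and denominators can be cleared. *)
Lemma int_relation (m : nat) (x : 'I_m -> K) : (\dim {:K} < m)%N ->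
  exists n : 'I_m -> int, (exists i, n i != 0) /\ \sum_i (n i)%:~R * x i = 0.
Proof.
move=> dm.
have : ~~ free [tuple x i | i < m].
  rewrite /free size_tuple neq_ltn; apply/orP; left.
  by apply: leq_ltn_trans dm; apply/dimvS/subvf.
move=> nf; have [c hc [i ci]] : exists2 c : 'I_m -> rat,
    \sum_(i < m) c i *: x i = 0 & exists i, c i != 0.
  apply: contrapT => H; move/negP: nf; apply; apply/freeP => c hc i.
  apply/eqP; apply: contrapT => /negP ci; apply: H; exists c; last by exists i.
  by rewrite -[RHS]hc; apply: eq_bigr => j _; rewrite -tnth_nth tnth_mktuple.
pose D := \prod_i denq (c i).
have D0 : D != 0 by apply/prodf_neq0 => j _; rewrite denq_neq0.
exists (fun j => numq (c j) * \prod_(l | l != j) denq (c l)); split.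
  exists i; rewrite mulf_neq0 // ?numq_eq0 //.
  by apply/prodf_neq0 => j _; rewrite denq_neq0.
transitivity ((D%:~R : rat) *: (0 : K)); last by rewrite scaler0.
rewrite -[X in _ *: X]hc scaler_sumr; apply: eq_bigr => j _.
have key : D%:~R * c j = (numq (c j) * \prod_(l | l != j) denq (c l))%:~R.
  rewrite /D (bigD1 j) //= !intrM mulrAC; congr (_ * _).
  by rewrite mulrC -{1}[c j]divq_num_den divfK // intr_eq0 denq_neq0.
by rewrite scalerA key scaler_int mulrzl.
Qed.

(** As long as p divides all coefficients they can be divided by p, and the
    sum of their absolute values decreases. A relation that survives modulo p
    carries upper bounds by the degree over to the places above p. *)
Lemma int_relation_prime (m : nat) (x : 'I_m -> K) (p : nat) :
  (\dim {:K} < m)%N -> (1 < p)%N ->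
  exists n : 'I_m -> int, (exists i, ~~ (p%:Z %| n i)%Z) /\
    \sum_i (n i)%:~R * x i = 0.
Proof.
move=> dm p1; have [n [[i ni] hn]] := int_relation x dm.
elim: {n}_.+1 {-2}n (ltnSn (\sum_j `|n j|%N)) i ni hn => // N IH n hN i ni hn.
have [h|h] := pselect (exists i, ~~ (p%:Z %| n i)%Z); first by exists n.
have {}h j : (p%:Z %| n j)%Z.
  by apply: contrapT => /negP hj; apply: h; exists j.
have E j : n j = (n j %/ p)%Z * p by rewrite divzK.
have A j : `|n j|%N = (`|(n j %/ p)%Z| * p)%N by rewrite {1}E abszM.
have ni0 : (n i %/ p)%Z != 0 by apply: contra ni => /eqP e; rewrite E e mul0r.
apply: (IH (fun j => (n j %/ p)%Z) _ i) => //.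
  have : (\sum_j `|(n j %/ p)%Z| < \sum_j `|n j|)%N; last by lia.
  rewrite [ltnRHS](bigD1 i) // [ltnLHS](bigD1 i) //=.
  rewrite -addSn leq_add //; first by rewrite A ltn_Pmulr // absz_gt0.
  by apply: leq_sum => j _; rewrite A leq_pmulr // ltnW.
apply: (@mulIf _ (p%:R : K)).
  by have := intr_fieldExt_eq0 p; rewrite -pmulrn => ->; lia.
rewrite mul0r mulr_suml -[RHS]hn; apply: eq_bigr => j _.
by rewrite [n j in RHS]E intrM mulrAC -pmulrn.
Qed.

End Valuation.

(** * Residue fields *)

Section Residue.
Variable K : fieldExtType rat.
Variable v : K -> int.
Hypothesis hv : finite_places v.

(** If all nonzero coefficients were units at v, the nonzero terms n_i x^i
    would have the distinct valuations i v(x), and the smallest one could not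
    cancel. *)
Lemma place_relation_coef (m : nat) (x : K) (n : 'I_m -> int) : x != 0 -> v x != 0 ->
  (exists i, n i != 0) -> \sum_i (n i)%:~R * x ^+ i = 0 ->
  exists2 i, n i != 0 & vge v 1 (n i)%:~R.
Proof.
move=> x0 vx [i0 ni0] hn; apply: contrapT => H.
have nv i : n i != 0 -> v (n i)%:~R = 0.
  move=> ni; have := vge_int hv (n i); rewrite vgeE ?intr_fieldExt_eq0 // => h0.
  apply/eqP; rewrite eq_le h0 andbT leNgt; apply/negP => h1; apply: H.
  by exists i => //; right; lia.
pose F i := (n i)%:~R * x ^+ i.
have vF i : n i != 0 -> F i != 0 /\ v (F i) = v x * i%:Z.
  move=> ni; rewrite /F (placeM hv) ?expf_neq0 ?intr_fieldExt_eq0 //.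
  by rewrite mulf_neq0 ?expf_neq0 ?intr_fieldExt_eq0 // nv // add0r placeX.
have [i ni imin] := @Order.TotalTheory.arg_minP _ _ _ i0 (fun i => n i != 0)
   (fun i : 'I_m => v x * i%:Z) ni0.
have [Fi vFi] := vF i ni.
move/eqP: hn; apply/negP; apply: (sum_dominant hv Fi) => j ji.
have [nj|nj] := eqVneq (n j) 0; first by left; rewrite /F nj mul0r.
right; have [_ ->] := vF j nj; rewrite vFi lt_neqAle imin // andbT.
apply: contra ji => /eqP /(mulfI vx) e; apply/eqP/val_inj.
by have /= := e; lia.
Qed.

(** A uniformiser satisfies an integer relation between its powers, so some
    nonzero integer has positive valuation. *)
Lemma place_prime : exists2 p : nat, prime p &
  forall n : int, vge v 1 (n%:~R : K) <-> (p%:Z %| n)%Z.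
Proof.
case: (hv) => _ _ _ [x x0 vx].
have vx0 : v x != 0 by rewrite vx.
have [n [nz hn]] := @int_relation K _ (fun i : 'I_(\dim {:K}).+1 => x ^+ i) (ltnSn _).
have [i ni vi] := place_relation_coef x0 vx0 nz hn.
apply: (int_prime_ideal (J := [set n : int | vge v 1 (n%:~R : K)])) => /=.
- by move=> a b ha hb; rewrite rmorphB /=; apply: vgeB.
- by exists (n i).
- by rewrite vgeE ?oner_neq0 // place1.
move=> a b; have [->|a0] := eqVneq a 0; first by left; left.
have [->|b0] := eqVneq b 0; first by right; left.
rewrite rmorphM /= !vgeE ?mulf_neq0 ?intr_fieldExt_eq0 // placeM ?intr_fieldExt_eq0 //.
by case: (leP 1 (v a%:~R)) => ?; [left|right; lia].
Qed.

Lemma valuation_idealE x : valuation_ideal v x = vge v 1 x.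
Proof.
by apply/propext; split; (case; [left|right; lia]).
Qed.

Lemma residue_classP x y :
  ([set z | valuation_ideal v (z - x)] = [set z | valuation_ideal v (z - y)])
  <-> vge v 1 (x - y).
Proof.
split => [/seteqP[/(_ x) /= h _]|h].
  by rewrite -valuation_idealE; apply: h; rewrite subrr; left.
apply/seteqP; split => z /=; rewrite !valuation_idealE => hz.
  by have := vgeD hv hz h; rewrite addrA subrK.
by have := vgeB hv hz h; rewrite opprB addrA subrK.
Qed.

(** Elements whose residues are independent over the field with p elements are
    independent over the rationals, because a dependency can be chosen that is
    not divisible by p. So a maximal family with independent residues has at
    most [K:Q] members, and its combinations with coefficients below p meet
    every residue class. *)
Lemma finite_residue_field : finite_set (residue_field v).
Proof.
have [p pp hp] := place_prime.
pose indep r := exists u : 'I_r -> K, (forall i, vge v 0 (u i)) /\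
  forall n : 'I_r -> int, vge v 1 (\sum_i (n i)%:~R * u i) ->
    forall i, (p%:Z %| n i)%Z.
have indep0 : exists r, `[< indep r >].
  by exists 0%N; apply/asboolP; exists (fun=> 0); split => [[]//|n _ []].
have bound r : `[< indep r >] -> (r <= \dim {:K})%N.
  move=> /asboolP [u [_ hu]]; rewrite leqNgt; apply/negP => dr.
  have [n [[i ni] hn]] := int_relation_prime u dr (prime_gt1 pp).
  by move/negP: ni; apply; apply: hu; rewrite hn; left.
case: (ex_maxnP indep0 bound) => r /asboolP [u [u0 hu]] rmax.
pose g (f : {ffun 'I_r -> 'I_p}) : set K :=
  [set z | valuation_ideal v (z - \sum_i (f i)%:R * u i)].
apply: (@sub_finite_set _ _ (g @` [set: {ffun 'I_r -> 'I_p}])); last first.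
  by apply: finite_image; apply: finite_finset.
move=> _ [x hx <-] /=.
pose u' i := if unlift ord0 i is Some j then u j else x : K.
have [n [hn [i ni]]] : exists n : 'I_r.+1 -> int,
    vge v 1 (\sum_i (n i)%:~R * u' i) /\ exists i, ~~ (p%:Z %| n i)%Z.
  apply: contrapT => H; suff /rmax : `[< indep r.+1 >] by rewrite ltnn.
  apply/asboolP; exists u'; split => [i|n hn i].
    by rewrite /u'; case: unliftP => [j _|_].
  by apply: contrapT => /negP ni; apply: H; exists n; split => //; exists i.
move: hn; rewrite big_ord_recl {1}/u' unlift_none => hn.
have {hn} hn : vge v 1 ((n ord0)%:~R * x + \sum_j (n (lift ord0 j))%:~R * u j).
  by move: hn; under eq_bigr => j _ do rewrite /u' liftK.
have n0p : ~~ (p%:Z %| n ord0)%Z.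
  apply/negP => n0p.
  have h1 : vge v 1 ((n ord0)%:~R * x).
    by rewrite -[1]addr0; apply: vgeM => //; apply/hp.
  have := vgeB hv hn h1; rewrite addrAC subrr add0r => h2.
  case: (unliftP ord0 i) ni => [j ->|->]; last by rewrite n0p.
  by rewrite (hu (fun j => n (lift ord0 j)) h2 j).
(* The coefficient of x is prime to p, so it can be normalised to 1 modulo p.
   *)
have [a ha] : exists a : int, (p%:Z %| a * n ord0 - 1)%Z.
  have : coprimez p (n ord0) by rewrite coprimezE /= prime_coprime // -dvdzE.
  move=> /coprimezP [[b a] /= e]; exists a.
  by apply/dvdzP; exists (- b); rewrite -e; ring.
have p_gt0 := prime_gt0 pp.
have fP (j : 'I_r) : (`|((- a * n (lift ord0 j)) %% p)%Z|%N < p)%N.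
  have : 0 <= ((- a * n (lift ord0 j)) %% p)%Z by apply: modz_ge0; lia.
  have : ((- a * n (lift ord0 j)) %% p)%Z < p by apply: ltz_pmod; lia.
  by lia.
exists [ffun j => Ordinal (fP j)] => //; rewrite /g.
apply/residue_classP.
pose w j := - a * n (lift ord0 j) - ((- a * n (lift ord0 j)) %% p)%Z.
have wE : - (x - \sum_i ([ffun j => Ordinal (fP j)] i)%:R * u i) =
   (a * n ord0 - 1)%:~R * x
   - a%:~R * ((n ord0)%:~R * x + \sum_j (n (lift ord0 j))%:~R * u j)
   - \sum_j (w j)%:~R * u j.
  have -> : \sum_j (w j)%:~R * u j = - a%:~R * (\sum_j (n (lift ord0 j))%:~R * u j)
     - \sum_i ([ffun j => Ordinal (fP j)] i)%:R * u i.
    rewrite mulr_sumr -sumrB; apply: eq_bigr => j _; rewrite ffunE /=.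
    rewrite pmulrn abszE ger0_norm; last by apply: modz_ge0; lia.
    by rewrite /w rmorphB /= rmorphM /= rmorphN /=; ring.
  by rewrite rmorphB /= rmorphM /=; ring.
rewrite -[_ - x]opprB wE.
apply: (vgeB hv); first apply: (vgeB hv).
- by rewrite -[1]addr0; apply: vgeM => //; apply/hp.
- by rewrite -[1]add0r; apply: vgeM => //; apply: vge_int.
apply: (vge_sum hv) => j _.
rewrite -[1]addr0; apply: vgeM => //; apply/hp; rewrite /w.
apply/dvdzP; exists ((- a * n (lift ord0 j)) %/ p)%Z.
by rewrite {1}(divz_eq (- a * n (lift ord0 j)) p); ring.
Qed.

Lemma residue_index : exists rho : K -> nat,
  (forall x, vge v 0 x -> (rho x < residue_card v)%N) /\
  forall x y, vge v 0 x -> vge v 0 y -> rho x = rho y -> vge v 1 (x - y).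
Proof.
pose cl x : set K := [set z | valuation_ideal v (z - x)].
have clP x : vge v 0 x -> cl x \in fset_set (residue_field v).
  move=> hx; rewrite in_fset_set ?inE; last exact: finite_residue_field.
  by exists x.
exists (fun x => index (cl x) (fset_set (residue_field v))); split.
  by move=> x hx; rewrite /residue_card index_mem; exact: clP.
move=> x y hx hy e; apply/residue_classP.
by rewrite -[LHS](nth_index set0 (clP x hx)) e nth_index //; apply: clP.
Qed.

Lemma residue_card_gt1 : (1 < residue_card v)%N.
Proof.
pose cl x : set K := [set z | valuation_ideal v (z - x)].
have clP x : vge v 0 x -> cl x \in fset_set (residue_field v).
  move=> hx; rewrite in_fset_set ?inE; last exact: finite_residue_field.
  by exists x.
have h0 : cl 0 \in fset_set (residue_field v) by apply: clP; left.
have h1 : cl 1 \in fset_set (residue_field v) by apply: clP; exact: vge1.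
have ne : cl 1 != cl 0.
  apply/eqP => /residue_classP; rewrite subr0 vgeE ?oner_neq0 //.
  by rewrite place1.
have := @uniq_leq_size _ [:: cl 1; cl 0] (fset_set (residue_field v)).
apply; first by rewrite /= inE ne.
by move=> z; rewrite !inE => /orP[] /eqP ->.
Qed.

(** The digits of x in base a uniformiser: the first digit is the residue
    class of x; subtracting a fixed representative of the class and dividing
    by the uniformiser leaves an element that is coded by n digits. *)
Lemma residue_code (n : nat) :
  has_code (vge v 0) (residue_card v ^ n) (fun x y => vge v n (x - y)).
Proof.
have [rho [rho_lt rhoP]] := residue_index.
case: (hv) => _ _ _ [pi pi0 vpi].
elim: n => [|n IH].
  by exists (fun=> 0%N); split => // x y hx hy _; apply: (vgeB hv).
pose rep i := xget 0 [set x | vge v 0 x /\ rho x = i].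
have repP x : vge v 0 x -> vge v 0 (rep (rho x)) /\ rho (rep (rho x)) = rho x.
  by move=> hx; apply: (@xgetPex _ 0 [set y | vge v 0 y /\ rho y = rho x]); exists x.
pose t x := (x - rep (rho x)) / pi.
have tP x : vge v 0 x -> vge v 0 (t x).
  move=> hx; have [h1 h2] := repP x hx.
  rewrite /t -[0](subrr 1); apply: vgeM => //; first exact: rhoP.
  by right; rewrite placeV // vpi.
have code_rho : has_code (vge v 0) (residue_card v) (fun x y => rho x = rho y).
  by exists rho.
have code_t : has_code (vge v 0) (residue_card v ^ n) (fun x y => vge v n (t x - t y)).
  have [f [f_lt fP]] := IH; exists (f \o t); split=> [x hx|x y hx hy].
    by apply/f_lt/tP.
  by apply: fP; apply: tP.
rewrite expnS; apply: sub_code (code_and code_rho code_t) => // x y hx hy [e h].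
have -> : x - y = pi * (t x - t y).
  by rewrite /t e -mulrBl mulrC divfK //; ring.
by rewrite intS; apply: vgeM => //; right; rewrite vpi.
Qed.

End Residue.

(** * Finiteness of the support *)

Section Support.
Variable K : fieldExtType rat.
Implicit Types (v w : K -> int) (x y : K).

Lemma place_dominantD v x y : finite_places v -> x != 0 ->
  vge v (v x + 1) y -> x + y != 0 /\ v (x + y) = v x.
Proof.
move=> hv x0 hy; have s0 := vge_dominant hv x0 hy; split => //.
apply/eqP; rewrite eq_le; apply/andP; split; last first.
  rewrite -(@vgeE _ v) //; apply: (vgeD hv); first exact: vge_refl.
  by apply: vge_le hy; lia.
rewrite leNgt; apply/negP => h.
have : vge v (v x + 1) (x + y - y) by apply: (vgeB hv) => //; right; lia.
by rewrite addrK vgeE //; lia.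
Qed.

(** Under the inclusion of valuation rings, w vanishes on the units of v, so w
    is a multiple of v; both have value group all the integers, so the factor
    is 1. *)
Lemma place_eq_of_subring v w : finite_places v -> finite_places w ->
  (forall x, vge v 0 x -> vge w 0 x) -> v = w.
Proof.
move=> hv hw h.
have unit x : x != 0 -> v x = 0 -> w x = 0.
  move=> x0 vx; have : vge w 0 x by apply: h; right; rewrite vx.
  have : vge w 0 x^-1 by apply: h; right; rewrite placeV // vx.
  rewrite !vgeE ?invr_neq0 // placeV //; lia.
case: (hv) => v0 _ _ [pi pi0 vpi]; case: (hw) => w0 _ _ [ro ro0 wro].
have pos : 0 <= w pi.
  have : vge w 0 pi by apply: h; right; rewrite vpi.
  by rewrite vgeE.
have unitX (k : nat) x : x != 0 -> v x = k -> w x = w pi * k.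
  move=> x0 vx.
  have := unit (x / pi ^+ k); rewrite mulf_neq0 ?invr_neq0 ?expf_neq0 //.
  rewrite (placeM hv) ?invr_neq0 ?expf_neq0 // (placeM hw) ?invr_neq0 ?expf_neq0 //.
  rewrite (placeV hv) ?(placeV hw) ?expf_neq0 // (placeX hv) // (placeX hw) //.
  by rewrite vx vpi mul1r subrr => /(_ isT erefl) /eqP; rewrite subr_eq0 => /eqP.
have E x : x != 0 -> w x = w pi * v x.
  move=> x0; case: (leP 0 (v x)) => s.
    by rewrite (unitX `|v x|%N) //; first congr (_ * _); rewrite abszE ger0_norm.
  have := @unitX `|v x|%N x^-1; rewrite invr_neq0 // !placeV // abszE.
  by rewrite ltr0_norm // => /(_ isT erefl); nia.
have w1 : w pi = 1.
  have := E ro ro0; rewrite wro => e.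
  have p0 : w pi != 0 by apply/eqP => p0; move: e; rewrite p0 mul0r.
  have r0 : 1 <= v ro by rewrite leNgt; apply/negP => r0; nia.
  by nia.
apply/funext => x; have [->|x0] := eqVneq x 0; first by rewrite v0 w0.
by rewrite E // w1 mul1r.
Qed.

(** The quotient of two elements, each lying in just one of the two valuation
    rings. *)
Lemma place_separate v w : finite_places v -> finite_places w -> v != w ->
  exists2 x, x != 0 & w x < 0 < v x.
Proof.
move=> hv hw vw.
have one (a b : K -> int) : finite_places a -> finite_places b -> a != b ->
    exists2 x, x != 0 & b x < 0 <= a x.
  move=> ha hb ab; apply: contrapT => H; move/eqP: ab; apply.
  apply: place_eq_of_subring => // x [->|hx]; first by left.
  have [->|x0] := eqVneq x 0; first by left.
  right; rewrite leNgt; apply/negP => bx; apply: H; exists x => //.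
  by rewrite bx.
have [x x0 /andP[wx vx]] := one v w hv hw vw.
have [y y0 /andP[vy wy]] : exists2 y, y != 0 & v y < 0 <= w y.
  by apply: one => //; rewrite eq_sym.
exists (x / y); first by rewrite mulf_neq0 ?invr_neq0.
by rewrite !placeM ?invr_neq0 // !placeV //; lia.
Qed.

(** Weak approximation, by induction on s. If the element y found for the
    other places is nonnegative at w, a high power of an element x that
    separates v from w is added: it makes the value at w negative and keeps
    the signs everywhere else. *)
Lemma place_approx v (s : seq (K -> int)) : finite_places v ->
  {in s, forall w, finite_places w} -> v \notin s ->
  exists2 x, x != 0 & 0 < v x /\ {in s, forall w, w x < 0}.
Proof.
move=> hv; elim: s => [_ _|w s IH hs].
  case: hv => _ _ _ [x x0 vx]; exists x => //.
  by split => //; rewrite vx.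
rewrite inE negb_or => /andP[vw vs].
have hw : finite_places w by apply: hs; rewrite inE eqxx.
have {}hs : {in s, forall w, finite_places w}.
  by move=> u us; apply: hs; rewrite inE us orbT.
have [y y0 [vy sy]] := IH hs vs.
have [wy|wy] := ltP (w y) 0.
  exists y => //; split => // u; rewrite inE => /orP[/eqP -> //|]; exact: sy.
have [x x0 /andP[wx vx]] := place_separate hv hw vw.
(* With this exponent, x^k is smaller than y at every place u of s with u(x) <
   0. *)
pose k := (\sum_(u <- s) `|u y|%N).+1.
have xk0 : x ^+ k != 0 by rewrite expf_neq0.
have [s0 ws] : x ^+ k + y != 0 /\ w (x ^+ k + y) = w (x ^+ k).
  by apply: place_dominantD => //; right; rewrite placeX //; nia.
exists (x ^+ k + y) => //; split.
  suff : vge v 1 (x ^+ k + y) by rewrite vgeE.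
  by apply: (vgeD hv); right; rewrite ?placeX //; nia.
move=> u; rewrite inE => /orP[/eqP ->|us].
  by rewrite ws placeX //; nia.
have hu := hs u us; have uy := sy u us.
have uk : (`|u y| < k)%N.
  by rewrite /k ltnS (big_rem u) //= leq_addr.
case: (ltP (u x) 0) => ux.
  have [_ ->] : x ^+ k + y != 0 /\ u (x ^+ k + y) = u (x ^+ k).
    by apply: place_dominantD => //; right; rewrite placeX //; nia.
  by rewrite placeX //; nia.
have [_] : y + x ^+ k != 0 /\ u (y + x ^+ k) = u y.
  by apply: place_dominantD => //; right; rewrite placeX //; nia.
by rewrite addrC => ->.
Qed.

(** Choose y_i negative at the i-th place and positive at the others. In an
    integer relation between the y_i that is not divisible by p, a term whose
    coefficient is prime to p dominates at its own place, so the y_i are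
    independent over the rationals. *)
Lemma places_over_prime_le (p : nat) (s : seq (K -> int)) : prime p -> uniq s ->
  {in s, forall v, finite_places v /\ vge v 1 p%:R} -> (size s <= \dim {:K})%N.
Proof.
move=> pp us hs; rewrite leqNgt; apply/negP => ds.
have ex (i : 'I_(size s)) : exists y, y != 0 /\ nth (fun=> 0) s i y < 0 /\
    forall j : 'I_(size s), j != i -> 0 < nth (fun=> 0) s j y.
  set v := nth _ s i; have vs : v \in s by apply: mem_nth.
  have [x x0 [vx sx]] := @place_approx v (rem v s) (hs v vs).1
      (fun w ws => (hs w (mem_rem ws)).1) (negbT (mem_rem_uniqF v us)).
  exists x^-1; rewrite invr_neq0 //; split => //.
  rewrite (placeV (hs v vs).1) //; split; first by lia.
  move=> j ji; set w := nth _ s j; have ws : w \in s by apply: mem_nth.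
  have := sx w; rewrite mem_rem_uniq // inE ws andbT (placeV (hs w ws).1) //.
  suff -> : w != v by move=> /(_ isT); lia.
  by rewrite /w /v nth_uniq.
have [y hy] := choice ex.
have [n [[i ni] hn]] := int_relation_prime y ds (prime_gt1 pp).
set v := nth (fun=> 0) s i in hy *.
have [hv vp] : finite_places v /\ vge v 1 p%:R by apply: hs; apply: mem_nth.
have [q qp hq] := place_prime hv.
have qE : q = p.
  apply/eqP; rewrite -dvdn_prime2 //.
  by move: vp; rewrite pmulrn => /hq.
have [yi0 [vyi hyj]] := hy i.
have ni0 : n i != 0 by apply: contra ni => /eqP ->; rewrite dvdz0.
have nK : (n i)%:~R != 0 :> K by rewrite intr_fieldExt_eq0.
have vn : v (n i)%:~R = 0.
  have := vge_int hv (n i); rewrite vgeE // => h0.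
  have [//|h1] : v (n i)%:~R = 0 \/ 1 <= v (n i)%:~R by lia.
  by move/negP: ni; case; rewrite -qE; apply/hq; right.
move/eqP: hn; apply/negP; apply: (@sum_dominant _ _ hv _ _ i).
  by rewrite mulf_neq0.
move=> j ji; have [->|nj] := eqVneq (n j) 0; first by left; rewrite mul0r.
right; have [yj0 [_ hj]] := hy j.
have nKj : (n j)%:~R != 0 :> K by rewrite intr_fieldExt_eq0.
rewrite !(placeM hv) // vn add0r.
have := vge_int hv (n j); rewrite vgeE // => h0.
have : 0 < v (y j) by apply: hj; rewrite eq_sym.
move: vyi; rewrite -/v; lia.
Qed.

Lemma finite_places_over (n : int) : n != 0 ->
  finite_set [set v : K -> int | finite_places v /\ vge v 1 n%:~R].
Proof.
move=> n0.
apply: (@sub_finite_set _ _ (\bigcup_(p in [set p | prime p /\ (p <= `|n|)%N])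
   [set v : K -> int | finite_places v /\ vge v 1 p%:R])).
  move=> v [hv vn]; have [p pp hp] := place_prime hv.
  exists p; first split => //.
    by apply: dvdn_leq; [rewrite absz_gt0|exact/hp].
  by split => //; rewrite pmulrn; apply/hp.
apply: bigcup_finite.
  apply: (@sub_finite_set _ _ `I_(`|n|.+1)); last exact: finite_II.
  by move=> p [_]; rewrite /= ltnS.
move=> p [pp _]; apply: contrapT => /(@infinite_set_fset _ _ (\dim {:K}).+1).
move=> [B Bs]; rewrite ltnNge => /negP; apply.
apply: (places_over_prime_le pp (fset_uniq B)) => v vB.
exact: (Bs v vB).
Qed.

(** At a place where x is not a unit, some coefficient of a fixed integer
    relation between the powers of x has positive valuation, and only finitely
    many places lie over a given nonzero integer. *)
Lemma finite_place_support x : x != 0 ->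
  finite_set [set v : K -> int | finite_places v /\ v x != 0].
Proof.
move=> x0.
have [n [nz hn]] := @int_relation K _ (fun i : 'I_(\dim {:K}).+1 => x ^+ i) (ltnSn _).
apply: (@sub_finite_set _ _ (\bigcup_(i in [set i | n i != 0])
   [set v : K -> int | finite_places v /\ vge v 1 (n i)%:~R])).
  by move=> v [hv vx]; have [i ni vi] := place_relation_coef hv x0 vx nz hn; exists i.
apply: bigcup_finite; first exact: finite_finset.
by move=> i /= ni; apply: finite_places_over.
Qed.

(** The ring of integers of K, described by its places. That its elements are
    algebraic integers is the content of [ringint_integral]. *)
Definition ringint : set K := [set x | forall v, finite_places v -> vge v 0 x].

Lemma ringint0 : ringint 0. Proof. by move=> v _; left. Qed.
Lemma ringint1 : ringint 1. Proof. by move=> v hv; exact: vge1. Qed.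
Lemma ringint_int (n : int) : ringint n%:~R.
Proof. by move=> v hv; exact: vge_int. Qed.
Lemma ringintD x y : ringint x -> ringint y -> ringint (x + y).
Proof. by move=> hx hy v hv; apply: vgeD; auto. Qed.
Lemma ringintB x y : ringint x -> ringint y -> ringint (x - y).
Proof. by move=> hx hy v hv; apply: vgeB; auto. Qed.
Lemma ringintM x y : ringint x -> ringint y -> ringint (x * y).
Proof. by move=> hx hy v hv; rewrite -[0]addr0; apply: vgeM; auto. Qed.
Lemma ringint_sum (I : Type) (r : seq I) (P : pred I) (F : I -> K) :
  (forall i, P i -> ringint (F i)) -> ringint (\sum_(i <- r | P i) F i).
Proof. by move=> h; apply: big_ind => //; [exact: ringint0|exact: ringintD]. Qed.
Lemma ringintX x (k : nat) : ringint x -> ringint (x ^+ k).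
Proof.
move=> h; elim: k => [|k IH]; first by rewrite expr0; exact: ringint1.
by rewrite exprS; apply: ringintM.
Qed.

(** The leading coefficient of an integer relation between the powers of x is
    a suitable factor: at a place where m x were not integral, the leading
    term could not cancel. *)
Lemma ringint_scale x : exists2 m : int, m != 0 & ringint (m%:~R * x).
Proof.
have [->|x0] := eqVneq x 0.
  by exists 1 => //; rewrite mulr0; exact: ringint0.
have [n [[i0 ni0] hn]] :=
  @int_relation K _ (fun i : 'I_(\dim {:K}).+1 => x ^+ i) (ltnSn _).
case: (@arg_maxnP _ i0 (fun i => n i != 0) (fun i => i : nat) ni0) => i ni imax.
have nK : (n i)%:~R != 0 :> K by rewrite intr_fieldExt_eq0.
exists (n i) => // v hv; right; rewrite leNgt; apply/negP.
rewrite placeM // => neg.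
have vn : 0 <= v (n i)%:~R by have := vge_int hv (n i); rewrite vgeE.
move/eqP: hn; apply/negP; apply: (@sum_dominant _ _ hv _ _ i).
  by rewrite mulf_neq0 // expf_neq0.
move=> j ji; have [->|nj] := eqVneq (n j) 0; first by left; rewrite mul0r.
right; have lt_ji : (j < i)%N by rewrite ltn_neqAle ji; exact: imax.
have nKj : (n j)%:~R != 0 :> K by rewrite intr_fieldExt_eq0.
have := vge_int hv (n j); rewrite vgeE // => vnj.
rewrite !(placeM hv) ?expf_neq0 // !(placeX hv) //.
have [t it] : exists t : nat, (i = (j + t).+1 :> nat)%N.
  by exists (i - j).-1; lia.
rewrite it; nia.
Qed.

End Support.

(** * Chevalley's construction of valuation rings *)

Section SubringClosure.
Variables (L : fieldType) (S : set L).
Hypothesis S1 : S 1.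
Hypothesis SB : forall x y, S x -> S y -> S (x - y).
Hypothesis SM : forall x y, S x -> S y -> S (x * y).

Lemma subring0 : S 0. Proof. by rewrite -(subrr 1); apply: SB. Qed.
Lemma subringN x : S x -> S (- x).
Proof. by move=> h; rewrite -sub0r; apply: SB => //; exact: subring0. Qed.
Lemma subringD x y : S x -> S y -> S (x + y).
Proof. by move=> hx /subringN /(SB hx); rewrite opprK. Qed.
Lemma subringX x (k : nat) : S x -> S (x ^+ k).
Proof.
move=> h; elim: k => [|k IH]; first by rewrite expr0.
by rewrite exprS; apply: (SM).
Qed.
Lemma subring_sum (I : Type) (r : seq I) (P : pred I) (F : I -> L) :
  (forall i, P i -> S (F i)) -> S (\sum_(i <- r | P i) F i).
Proof. by move=> h; apply: big_ind => //; [exact: subring0|exact: subringD]. Qed.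
Lemma subring_int (n : int) : S n%:~R.
Proof.
have Snat (k : nat) : S k%:R.
  by elim: k => [|k IH]; [exact: subring0|rewrite -natr1; apply: subringD].
case: n => n; first exact: Snat.
by rewrite NegzE mulrNz; apply/subringN/Snat.
Qed.
End SubringClosure.

Lemma expr_subV (L : fieldType) (t : L) (n i : nat) : t != 0 -> (i <= n)%N ->
  t ^+ n * t^-1 ^+ i = t ^+ (n - i).
Proof.
by move=> t0 le; rewrite -{1}(subnK le) exprD exprVn mulfK // expf_neq0.
Qed.

Section Chevalley.
Variables (L : fieldType) (z : L).
Hypothesis z0 : z != 0.

Definition nonunit_subring (S : set L) : Prop :=
  [/\ S 1, forall x y, S x -> S y -> S (x - y), forall x y, S x -> S y -> S (x * y),
      S z & forall s, S s -> z * s != 1].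

Definition adjoin_subring (S : set L) (x : L) : set L :=
  [set p.[x] | p in [set p : {poly L} | forall i, S p`_i]].

Lemma adjoin_nonunit_subring S x : nonunit_subring S ->
  (forall y, adjoin_subring S x y -> z * y != 1) -> nonunit_subring (adjoin_subring S x).
Proof.
move=> [S1 SB SM Sz _] h.
have S0 := subring0 S1 SB.
have cst s : S s -> adjoin_subring S x s.
  move=> hs; exists s%:P; last by rewrite hornerC.
  by move=> i /=; rewrite coefC; case: eqP.
split => //; try exact: cst.
- move=> _ _ [p hp <-] [q hq <-]; exists (p - q); last by rewrite hornerD hornerN.
  by move=> i /=; rewrite coefB; apply: SB.
- move=> _ _ [p hp <-] [q hq <-]; exists (p * q); last by rewrite hornerM.
  move=> i /=; rewrite coefM; apply: (subring_sum S1 SB) => j _.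
  exact: SM.
Qed.

Definition maximal_subring (S : set L) :=
  nonunit_subring S /\ forall B, S `<` B -> ~ nonunit_subring B.

Lemma maximal_adjoin S x : maximal_subring S -> ~ S x ->
  exists2 p : {poly L}, (forall i, S p`_i) & z * p.[x] = 1.
Proof.
move=> [Sp Smax] Sx; apply: contrapT => H.
have [S1 SB SM Sz _] := Sp.
(* Otherwise S[x] would be a strictly larger ring in which z is not
   invertible. *)
apply: (Smax (adjoin_subring S x)); last first.
  apply: adjoin_nonunit_subring => // y [p hp <-].
  by apply/eqP => e; apply: H; exists p.
split.
  move=> s hs; exists s%:P; last by rewrite hornerC.
  by move=> i /=; rewrite coefC; case: eqP => // _; exact: subring0.
move=> /(_ x) H'; apply: Sx; apply: H'; exists 'X; last by rewrite hornerX.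
by move=> i /=; rewrite coefX; case: eqP => // _; exact: subring0.
Qed.

(** Otherwise adjoining the inverse of t = 1 - z s makes z invertible.
    Clearing denominators, a power of t lies in z S; but powers of t are
    congruent to 1 modulo z S. *)
Lemma maximal_unit S s : maximal_subring S -> S s -> S (1 - z * s)^-1.
Proof.
move=> Smax hs; apply: contrapT => Sy.
have [[S1 SB SM Sz Sn] _] := Smax.
have t0 : 1 - z * s != 0 by rewrite subr_eq0 eq_sym Sn.
have [p hp e] := maximal_adjoin Smax Sy.
set t := 1 - z * s in t0 Sy e.
have tP (k : nat) : exists2 b, S b & t ^+ k = 1 - z * b.
  elim: k => [|k [b hb IH]].
    by exists 0; [exact: subring0|rewrite mulr0 subr0].
  exists (s + b - z * s * b).
    apply: (SB); [apply: (subringD S1 SB) => //|].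
    by do 2?apply: (SM).
  by rewrite exprS IH /t; ring.
have [b hb eb] := tP (size p).
have hc : S (\sum_(i < size p) p`_i * t ^+ (size p - i)).
  apply: (subring_sum S1 SB) => i _; apply: (SM) => //; apply: subringX => //.
  by rewrite /t; apply: SB => //; apply: (SM).
move/eqP: (Sn _ (subringD S1 SB hb hc)); apply.
rewrite mulrDr (_ : z * b = 1 - t ^+ size p); last by rewrite eb; ring.
suff -> : z * \sum_(i < size p) p`_i * t ^+ (size p - i) = t ^+ size p by ring.
rewrite -[RHS]mulr1 -e horner_coef mulrCA; congr (_ * _).
rewrite mulr_sumr; apply: eq_bigr => i _; rewrite mulrCA; congr (_ * _).
by rewrite expr_subV // ltnW.
Qed.

(** Chevalley's argument. If neither x nor its inverse lies in S, adjoining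
    either of them makes z invertible, so that z p(x) = 1 and z q(1/x) = 1
    with p and q over S. Let deg q <= deg p = n, which is no restriction as x
    and its inverse play symmetric parts. Since 1 - z q_0 is a unit of S, the
    second equation expresses x^n by lower powers of x, and p can be replaced
    by a polynomial of smaller degree. *)
Lemma maximal_valuation S x : maximal_subring S -> S x \/ S x^-1.
Proof.
move=> Smax; have [[S1 SB SM Sz Sn] _] := Smax.
have [->|x0] := eqVneq x 0; first by left; exact: subring0.
apply: contrapT => H.
have [p hp ep] : exists2 p : {poly L}, (forall i, S p`_i) & z * p.[x] = 1.
  by apply: maximal_adjoin => // h; apply: H; left.
have [q hq eq] : exists2 q : {poly L}, (forall i, S q`_i) & z * q.[x^-1] = 1.
  by apply: maximal_adjoin => // h; apply: H; right.
elim: {p q}(size p + size q).+1 {-2}p {-2}q (ltnSn (size p + size q)) x x0 {H} hp ep hq eq => // N IH p q.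
wlog le_qp : p q / (size q <= size p)%N => [W|].
  case: (leqP (size q) (size p)); first exact: W.
  move=> pq hN x x0 hp ep hq eq.
  by apply: (W q p (ltnW pq) _ x^-1) => //; rewrite ?invr_eq0 ?invrK 1?addnC.
move=> hN x x0 hp ep hq eq.
case sp: (size p) => [|n].
  by move/eqP: sp; rewrite size_poly_eq0 => /eqP p0; move/eqP: ep;
    rewrite p0 horner0 mulr0 eq_sym oner_eq0.
set u := (1 - z * q`_0)^-1.
have Su : S u by apply: maximal_unit.
have t0 : 1 - z * q`_0 != 0 by rewrite subr_eq0 eq_sym Sn.
have xn : x ^+ n = u * (z * \sum_(i < n) q`_(n - i) * x ^+ i).
  apply: (mulfI t0); rewrite mulrA divff // mul1r mulrBl mul1r.
  apply/eqP; rewrite subr_eq; apply/eqP.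
  have sq : (size q <= n.+1)%N by rewrite -sp.
  rewrite -[LHS]mulr1 -eq (horner_coef_wide _ sq) big_ord_recl /= expr0 mulr1.
  rewrite mulrCA mulrDr mulrDr [RHS]addrC; congr (_ + _); first by ring.
  congr (_ * _); rewrite mulr_sumr (reindex_inj rev_ord_inj) /=.
  apply: eq_bigr => i _; rewrite /bump /= add1n subnSK // mulrCA; congr (_ * _).
  by rewrite expr_subV ?leq_subr // subKn // ltnW.
(* The leading term p_n x^n, rewritten in lower powers of x. *)
pose p' := \poly_(i < n) (p`_i + p`_n * (u * (z * q`_(n - i)))).
have sp' : (size p' <= n)%N by apply: size_poly.
apply: (IH p' q _ x) => //.
- by have := hN; rewrite sp; lia.
- move=> i; rewrite coef_poly; case: ifP => _; last exact: subring0.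
  by apply: (subringD S1 SB) => //; do !apply: (SM) => //.
rewrite horner_poly -ep horner_coef sp big_ord_recr /= xn; congr (_ * _).
under eq_bigr => i _ do rewrite mulrDl.
rewrite big_split /=; congr (_ + _); rewrite !mulr_sumr.
by apply: eq_bigr => i _; ring.
Qed.

(** If z were invertible in Z[z], an equation z p(z) = 1, multiplied by a
    power of the inverse of z, would be a monic equation for this inverse. So
    Z[z] is a starting point for Zorn's lemma. *)
Lemma exists_maximal_subring :
  ~ integralOver (intr : int -> L) z^-1 -> exists S, maximal_subring S.
Proof.
move=> nint.
pose S0 : set L := [set (map_poly intr p).[z] | p in [set: {poly int}]].
have good0 : nonunit_subring S0.
  split.
  - by exists 1 => //; rewrite rmorph1 hornerE.
  - by move=> _ _ [p _ <-] [q _ <-]; exists (p - q) => //; rewrite rmorphB /= hornerD hornerN.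
  - by move=> _ _ [p _ <-] [q _ <-]; exists (p * q) => //; rewrite rmorphM /= hornerM.
  - by exists 'X => //; rewrite map_polyX hornerX.
  move=> _ [p _ <-]; apply/eqP => e; apply: nint.
  pose n := size p.
  pose r : {poly int} := \poly_(j < n) p`_(n.-1 - j).
  exists ('X^n - r).
    rewrite monicE lead_coefDl ?lead_coefXn // size_polyXn size_polyN ltnS.
    exact: size_poly.
  rewrite /root rmorphB /= map_polyXn hornerD hornerN hornerXn subr_eq0; apply/eqP.
  rewrite -[LHS]mulr1 -[X in _ * X]e (@horner_coef_wide _ n); last exact: size_poly.
  have -> : map_poly intr r = \poly_(j < n) (p`_(n.-1 - j))%:~R :> {poly L}.
    by apply/polyP => i; rewrite coef_map !coef_poly; case: ifP.
  rewrite horner_poly mulrA mulr_sumr [RHS](reindex_inj rev_ord_inj) /=.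
  apply: eq_bigr => i _; rewrite coef_map /= mulrCA; congr (_%:~R * _).
    by congr (p`_ _); case: i => i /= hi; lia.
  by have := @expr_subV _ z^-1 n i.+1; rewrite invrK exprS mulrA => -> //; rewrite invr_eq0.
(* The empty set is admitted because it is the union of the empty chain. *)
pose P (S : set L) := S = set0 \/ nonunit_subring S.
have [F FP tot|A [[A0|Ap] Amax]] := @Zorn_bigcup _ P.
- have [[S FS Sp]|H] := pselect (exists2 S, F S & nonunit_subring S); last first.
    left; apply/seteqP; split => // x [S FS Sx].
    have [S0'|Sp] := FP _ FS; first by move: Sx; rewrite S0'.
    by case: H; exists S.
  right.
  have two x y : (\bigcup_(X in F) X) x -> (\bigcup_(X in F) X) y ->
      exists T, [/\ F T, nonunit_subring T, T x & T y].
    move=> [X FX Xx] [Y FY Yy].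
    have pX : nonunit_subring X by case: (FP _ FX) => // X0; move: Xx; rewrite X0.
    have pY : nonunit_subring Y by case: (FP _ FY) => // Y0; move: Yy; rewrite Y0.
    have [XY|YX] := tot _ _ FX FY.
      by exists Y; split => //; apply: XY.
    by exists X; split => //; apply: YX.
  have [S1 _ _ Sz _] := Sp.
  split; try by exists S.
  + by move=> x y hx hy; have [T [FT [_ TB _ _ _] Tx Ty]] := two x y hx hy; exists T => //; apply: TB.
  + by move=> x y hx hy; have [T [FT [_ _ TM _ _] Tx Ty]] := two x y hx hy; exists T => //; apply: TM.
  by move=> x hx; have [T [FT [_ _ _ _ Tn] Tx _]] := two x x hx hx; apply: Tn.
- exfalso; apply: (Amax S0); last by right.
  by rewrite A0; split => // H; case: good0 => /H [].
exists A; split => // B AB Bp; apply: (Amax B AB); by right.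
Qed.

End Chevalley.

(** * The place of a valuation ring *)

Section PlaceOfValuationRing.
Variables (K : fieldExtType rat) (S : set K) (z : K).
Hypothesis S1 : S 1.
Hypothesis SB : forall x y, S x -> S y -> S (x - y).
Hypothesis SM : forall x y, S x -> S y -> S (x * y).
Hypothesis SV : forall x, S x \/ S x^-1.
Hypothesis Sz : S z.
Hypothesis Szi : ~ S z^-1.

Local Notation S0 := (subring0 S1 SB).

Definition nonunit : set K := [set x | x = 0 \/ ~ S x^-1].

Lemma nonunit1 : ~ nonunit 1.
Proof. by case=> [/eqP|]; [rewrite oner_eq0|rewrite invr1]. Qed.

Lemma nonunitM a x : S a -> nonunit x -> nonunit (a * x).
Proof.
move=> ha [->|hx]; first by left; rewrite mulr0.
have [->|a0] := eqVneq a 0; first by left; rewrite mul0r.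
right=> h; apply: hx; have := SM ha h.
by rewrite invfM mulrA divff // mul1r.
Qed.

Lemma nonunitD x y : nonunit x -> nonunit y -> nonunit (x + y).
Proof.
move=> hx hy.
have [x0|x0] := eqVneq x 0; first by rewrite x0 add0r.
have [y0|y0] := eqVneq y 0; first by rewrite y0 addr0.
have [h|h] := SV (x / y).
  have -> : x + y = (1 + x / y) * y by rewrite mulrDl mul1r divfK // addrC.
  by apply: nonunitM => //; apply: (subringD S1 SB).
have -> : x + y = (1 + y / x) * x by rewrite mulrDl mul1r divfK.
by apply: nonunitM => //; apply: (subringD S1 SB) => //; rewrite -invf_div.
Qed.

Lemma nonunitN x : nonunit x -> nonunit (- x).
Proof. by move=> h; rewrite -mulN1r; apply: nonunitM => //; apply: (subringN S1 SB). Qed.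

Lemma nonunit_sum (I : Type) (r : seq I) (P : pred I) (F : I -> K) :
  (forall i, P i -> nonunit (F i)) -> nonunit (\sum_(i <- r | P i) F i).
Proof. by move=> h; apply: big_ind => //; [left|exact: nonunitD]. Qed.

(** z is algebraic: in an integer relation between its powers, the lowest
    nonzero coefficient is a multiple of z in S, hence not a unit. *)
Lemma nonunit_prime : exists2 p : nat, prime p &
  forall n : int, nonunit n%:~R <-> (p%:Z %| n)%Z.
Proof.
apply: (int_prime_ideal (J := [set n : int | nonunit n%:~R])) => /=.
- move=> m n hm hn; rewrite rmorphB /=; apply: nonunitD => //; exact: nonunitN.
- have [n [[i0 ni0] hn]] :=
    @int_relation K _ (fun i : 'I_(\dim {:K}).+1 => z ^+ i) (ltnSn _).
  case: (@arg_minnP _ i0 (fun i => n i != 0) (fun i => i : nat) ni0) => i ni imin.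
  have z0 : z != 0 by apply/eqP => z0; apply: Szi; rewrite z0 invr0; exact: S0.
  have nK : (n i)%:~R != 0 :> K by rewrite intr_fieldExt_eq0.
  exists (n i) => //; right => Si; apply: Szi.
  pose c := \sum_(j < (\dim {:K}).+1 | j != i) (n j)%:~R * z ^+ (j - i.+1).
  suff -> : z^-1 = (n i)%:~R^-1 * - c.
    apply: SM => //; apply: (subringN S1 SB); apply: (subring_sum S1 SB) => j _.
    by apply: SM; [apply: (subring_int S1 SB)|apply: (subringX S1 SM)].
  have e : (n i)%:~R = - (c * z).
    apply: (mulIf (expf_neq0 i z0)); apply/eqP; rewrite mulNr -addr_eq0.
    rewrite -hn (bigD1 i) //=; apply/eqP; congr (_ + _).
    rewrite /c !mulr_suml; apply: eq_bigr => j ji.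
    have [->|nj] := eqVneq (n j) 0; first by rewrite !mul0r.
    have lt_ij : (i < j)%N by rewrite ltn_neqAle eq_sym ji; exact: imin.
    by rewrite -!mulrA -exprS -exprD subnK.
  apply: (mulfI nK); rewrite mulrA divff // mul1r e mulNr.
  by rewrite mulfK.
- exact: nonunit1.
move=> m n; rewrite rmorphM /= => -[/eqP|h].
  by rewrite mulf_eq0 => /orP[] /eqP ->; [left; left|right; left].
apply: contrapT => H; apply: h.
have um : S m%:~R^-1.
  by apply: contrapT => h; apply: H; left; right.
have un : S n%:~R^-1.
  by apply: contrapT => h; apply: H; right; right.
by rewrite invfM; apply: SM.
Qed.

Definition ring_unit : set K := [set x | [/\ x != 0, S x & S x^-1]].

Lemma ring_unitM x y : ring_unit x -> ring_unit y -> ring_unit (x * y).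
Proof.
move=> [x0 hx hx'] [y0 hy hy']; split; first by rewrite mulf_neq0.
  exact: SM.
by rewrite invfM; exact: SM.
Qed.

Lemma ring_unitV x : ring_unit x -> ring_unit x^-1.
Proof. by move=> [x0 hx hx']; split; rewrite ?invr_eq0 ?invrK. Qed.

Lemma ring_unitX x (k : nat) : ring_unit x -> ring_unit (x ^+ k).
Proof.
move=> hx; elim: k => [|k IH]; last by rewrite exprS; apply: ring_unitM.
by rewrite expr0; split; rewrite ?oner_eq0 ?invr1.
Qed.

Lemma ring_unit_int_part (p : nat) (n : int) : prime p ->
  (forall n : int, nonunit n%:~R <-> (p%:Z %| n)%Z) -> n != 0 ->
  exists a : nat, ring_unit (n%:~R / p%:R ^+ a).
Proof.
move=> pp hp n0; exists (logn p `|n|).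
have n0' : (0 < `|n|)%N by rewrite absz_gt0.
have [m hm en] := pfactor_coprime pp n0'.
have pK : (p%:R : K) != 0 by rewrite pmulrn intr_fieldExt_eq0; have := prime_gt0 pp; lia.
have -> : n%:~R / p%:R ^+ logn p `|n| = (sgz n * m)%:~R :> K.
  rewrite {1}(intEsg n) {1}en PoszM mulrA intrM -(pmulrn _ (p ^ _)%N) natrX.
  by rewrite mulfK // expf_neq0.
have u : ~ nonunit (sgz n * m)%:~R.
  move/hp; rewrite dvdzE abszM absz_sg n0 mul1n /= => pm.
  by move: hm; rewrite prime_coprime // pm.
have nz : (sgz n * m)%:~R != 0 :> K by apply/eqP => h; apply: u; left.
split => //; first exact: (subring_int S1 SB).
by apply: contrapT => h; apply: u; right.
Qed.

(** Divisibility in a valuation ring is a total preorder, so finitely many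
    elements include one that divides all the others. *)
Lemma exists_dividing_all (T : finType) (P : pred T) (t : T -> K) (i0 : T) : P i0 ->
  (forall i, P i -> t i != 0) -> exists2 i, P i & forall j, P j -> S (t j / t i).
Proof.
move=> Pi0 nz.
suff H (s : seq T) : {subset s <= P} ->
    exists2 i, P i & forall j, j \in s -> S (t j / t i).
  have [|i Pi hi] := H (enum P); first by move=> j; rewrite mem_enum.
  by exists i => // j Pj; apply: hi; rewrite mem_enum.
elim: s => [|j s IH] hs; first by exists i0.
have [|i Pi hi] := IH; first by move=> l ls; apply: hs; rewrite inE ls orbT.
have Pj : P j by apply: hs; rewrite inE eqxx.
have [h|h] := SV (t j / t i).
  by exists i => // l; rewrite inE => /orP[/eqP -> //|]; apply: hi.
exists j => // l; rewrite inE => /orP[/eqP ->|ls]; first by rewrite divff ?nz.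
have -> : t l / t j = (t l / t i) * (t j / t i)^-1.
  by rewrite invf_div mulrA divfK ?nz.
by apply: SM => //; apply: hi.
Qed.

(** This is where discreteness comes from. In an integer relation between the
    powers of x, the term that divides all the others cannot be strictly
    smallest, so two terms n_i x^i and n_j x^j agree up to a unit; nonzero
    integers are powers of p up to units, so x^(j - i) is one as well. As j -
    i is at most [K:Q], one exponent [K:Q]! serves for all x. *)
Lemma ring_unit_power (p : nat) (x : K) : prime p ->
  (forall n : int, nonunit n%:~R <-> (p%:Z %| n)%Z) -> x != 0 ->
  exists M : int, ring_unit (x ^+ (\dim {:K})`! / p%:R ^ M).
Proof.
move=> pp hp x0.
have pK : (p%:R : K) != 0 by rewrite pmulrn intr_fieldExt_eq0; have := prime_gt0 pp; lia.
have [n [[i0 ni0] hn]] :=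
  @int_relation K _ (fun i : 'I_(\dim {:K}).+1 => x ^+ i) (ltnSn _).
pose t i := (n i)%:~R * x ^+ i.
have tz (i : 'I_(\dim {:K}).+1) : n i != 0 -> t i != 0.
  by move=> ni; rewrite mulf_neq0 ?expf_neq0 ?intr_fieldExt_eq0.
have [i ni hi] := @exists_dividing_all _ (fun i => n i != 0) t i0 ni0 tz.
have [j [ji nj uj]] : exists j, [/\ j != i, n j != 0 & ring_unit (t j / t i)].
  apply: contrapT => H; apply: nonunit1.
  have -> : 1 = - \sum_(j | j != i) t j / t i.
    apply/eqP; rewrite -addr_eq0 -(divff (tz i ni)) -(bigD1 (P := predT) i (F := fun j => t j / t i)) //.
    by rewrite -mulr_suml hn mul0r.
  apply/nonunitN/nonunit_sum => j ji.
  have [e|nj] := eqVneq (n j) 0; first by left; rewrite /t e !mul0r.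
  right=> h; apply: H; exists j; split => //; split => //; last exact: hi.
  by rewrite mulf_neq0 ?invr_eq0 ?tz.
have [a [b [ab na nb u]]] : exists a b : 'I_(\dim {:K}).+1,
    [/\ (a < b)%N, n a != 0, n b != 0 & ring_unit (t b / t a)].
  have [lt|gt|e] := ltngtP i j.
  - by exists i, j.
  - by exists j, i; split => //; rewrite -invf_div; apply: ring_unitV.
  by move: ji; rewrite (val_inj e) eqxx.
have [la ha] := ring_unit_int_part pp hp na.
have [lb hb] := ring_unit_int_part pp hp nb.
have he : (0 < b - a <= \dim {:K})%N.
  by rewrite subn_gt0 ab /=; have := ltn_ord b; lia.
have ue : ring_unit (x ^+ (b - a) * (p%:R ^+ lb / p%:R ^+ la)).
  have -> : x ^+ (b - a) * (p%:R ^+ lb / p%:R ^+ la) =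
      t b / t a * ((n a)%:~R / p%:R ^+ la) * ((n b)%:~R / p%:R ^+ lb)^-1.
    rewrite /t -{2}(subnK (ltnW ab)) exprD.
    field; rewrite !expf_neq0 // !intr_fieldExt_eq0 na nb //=.
  by apply: ring_unitM; [apply: ring_unitM|apply: ring_unitV].
have /dvdnP [k hk] : (b - a %| (\dim {:K})`!)%N by apply: dvdn_fact.
exists ((la%:Z - lb%:Z) * k%:Z); rewrite hk mulnC exprM.
have -> : (x ^+ (b - a)) ^+ k / p%:R ^ ((la%:Z - lb%:Z) * k%:Z) =
    (x ^+ (b - a) * (p%:R ^+ lb / p%:R ^+ la)) ^+ k.
  rewrite [RHS]exprMn -exprz_exp expfzDr // -exprnN -!exprnP -exprVn.
  by rewrite invf_div.
exact: ring_unitX.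
Qed.

(** Write phi(x) for the exponent such that x^E is p^phi(x) up to a unit. It
    is a homomorphism to the integers, nonnegative exactly on S; dividing by
    the generator of its image normalises it. *)
Lemma valuation_ring_place : exists2 v : K -> int, finite_places v &
  forall x, x != 0 -> S x <-> 0 <= v x.
Proof.
have [p pp hp] := nonunit_prime.
have pK : (p%:R : K) != 0 by rewrite pmulrn intr_fieldExt_eq0; have := prime_gt0 pp; lia.
have pN : ~ S p%:R^-1.
  have : nonunit p%:~R by apply/hp; rewrite dvdzz.
  by case=> // /eqP; rewrite -pmulrn (negPf pK).
have Sp (k : nat) : S (p%:R ^+ k).
  by apply: (subringX S1 SM); rewrite pmulrn; apply: (subring_int S1 SB).
have pneg (k : nat) : ~ S (p%:R ^+ k.+1)^-1.
  move=> h; apply: pN; have := SM (Sp k) h.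
  by rewrite exprSr invfM mulrA mulfV ?expf_neq0 // mul1r.
have Spz (M : int) : S (p%:R ^ M) -> 0 <= M.
  by case: M => // k; rewrite NegzE -exprnN => /pneg.
have uz (M : int) : ring_unit (p%:R ^ M) -> M = 0.
  move=> [_ h1 h2]; apply/eqP; rewrite eq_le Spz // andbT -oppr_ge0.
  by apply: Spz; rewrite -invr_expz.
have [E E0 hE] : exists2 E : nat, (0 < E)%N &
    forall x : K, x != 0 -> exists M : int, ring_unit (x ^+ E / p%:R ^ M).
  by exists (\dim {:K})`!; [apply: fact_gt0|move=> x; apply: ring_unit_power].
have /choice [phi hphi] : forall x : K, exists M, x != 0 -> ring_unit (x ^+ E / p%:R ^ M).
  move=> x; have [->|x0] := eqVneq x 0; first by exists 0.
  by have [M hM] := hE x x0; exists M.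
have uniqM x M : x != 0 -> ring_unit (x ^+ E / p%:R ^ M) -> phi x = M.
  move=> x0 h; apply/eqP; rewrite -subr_eq0; apply/eqP; apply: uz.
  have := ring_unitM h (ring_unitV (hphi x x0)).
  suff -> : x ^+ E / p%:R ^ M * (x ^+ E / p%:R ^ phi x)^-1 = p%:R ^ (phi x - M) by [].
  rewrite expfzDr // -invr_expz invf_div mulrC mulrA.
  by rewrite divfK // expf_neq0.
have phiM x y : x != 0 -> y != 0 -> phi (x * y) = phi x + phi y.
  move=> x0 y0; apply: uniqM; first by rewrite mulf_neq0.
  have := ring_unitM (hphi x x0) (hphi y y0).
  suff -> : x ^+ E / p%:R ^ phi x * (y ^+ E / p%:R ^ phi y) =
    (x * y) ^+ E / p%:R ^ (phi x + phi y) by [].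
  by rewrite expfzDr // exprMn invfM; ring.
have phi1 : phi 1 = 0.
  apply: uniqM; rewrite ?oner_neq0 // expr1n expr0z divr1.
  by split; rewrite ?oner_neq0 ?invr1.
have phiV x : x != 0 -> phi x^-1 = - phi x.
  move=> x0; have := phiM x x^-1 x0; rewrite invr_eq0 mulfV // phi1 => /(_ x0).
  lia.
have phip : phi p%:R = E.
  apply: uniqM => //; rewrite -exprnP divff ?expf_neq0 //.
  by split; rewrite ?oner_neq0 ?invr1.
have phi_pos x : x != 0 -> S x -> 0 <= phi x.
  move=> x0 hx; apply: Spz.
  have [_ _ h] := hphi x x0.
  have := SM (subringX S1 SM E hx) h.
  by rewrite invf_div mulrCA mulfV ?mulr1 // expf_neq0.
have phi_S x : x != 0 -> S x <-> 0 <= phi x.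
  move=> x0; split; first exact: phi_pos.
  move=> h; have [//|hi] := SV x.
  have := phi_pos _ (invr_neq0 x0) hi; rewrite phiV // => h'.
  have e : phi x = 0 by lia.
  have [_ h1 _] := hphi x x0; move: h1; rewrite e expr0z divr1 => h1.
  have -> : x = x ^+ E * x^-1 ^+ E.-1.
    by rewrite expr_subV ?leq_pred // -{1}(prednK E0) subSnn expr1.
  by apply: SM => //; apply: (subringX S1 SM).
have [g g0 hg] : exists2 g : nat, (0 < g)%N & forall n,
    (exists2 x, x != 0 & phi x = n) <-> (g%:Z %| n)%Z.
  apply: (int_subgroup (J := [set n | exists2 x, x != 0 & phi x = n])).
    move=> m n [x x0 <-] [y y0 <-]; exists (x / y); first by rewrite mulf_neq0 ?invr_eq0.
    by rewrite phiM ?invr_eq0 // phiV.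
  by exists E%:Z; [lia|exists p%:R].
have phig x : x != 0 -> phi x = (phi x %/ g)%Z * g.
  by move=> x0; rewrite divzK //; apply/hg; exists x.
pose v x := if x == 0 then 0 else (phi x %/ g)%Z.
have vE x : x != 0 -> phi x = v x * g.
  by move=> x0; rewrite /v (negPf x0); exact: phig.
have vS x : x != 0 -> S x <-> 0 <= v x.
  by move=> x0; rewrite phi_S // vE //; split; nia.
have vM x y : x != 0 -> y != 0 -> v (x * y) = v x + v y.
  move=> x0 y0; have := phiM x y x0 y0; rewrite !vE ?mulf_neq0 //; nia.
have vV x : x != 0 -> v x^-1 = - v x.
  move=> x0; have := phiV x x0; rewrite !vE ?invr_eq0 //; nia.
exists v => //; split => //.
- by rewrite /v eqxx.
- have half x y : x != 0 -> y != 0 -> x + y != 0 -> S (x / y) -> v y <= v (x + y).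
    move=> x0 y0 s0 h.
    have : S ((x + y) / y) by rewrite mulrDl divff //; apply: (subringD S1 SB).
    rewrite vS ?mulf_neq0 ?invr_eq0 // vM ?invr_eq0 // vV //; lia.
  move=> x y x0 y0 s0; have [h|h] := SV (x / y).
    by rewrite ge_min half ?orbT.
  rewrite invf_div in h; move: (s0); rewrite addrC => s0'.
  by rewrite ge_min half.
have [x x0 hx] : exists2 x, x != 0 & phi x = g by apply/hg; rewrite dvdzz.
by exists x => //; have := vE x x0; rewrite hx; nia.
Qed.

End PlaceOfValuationRing.

(** If x is not integral over Z, its inverse is a non-unit of some valuation
    ring of K, and the place of that ring is negative at x. *)
Theorem ringint_integral (K : fieldExtType rat) (x : K) :
  ringint x -> integralOver (intr : int -> K) x.
Proof.
move=> hx; apply: contrapT => nint.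
have x0 : x != 0 by apply/eqP => x0; apply: nint; rewrite x0; exact: mxpoly.integral0.
have z0 : x^-1 != 0 by rewrite invr_eq0.
have [|S Smax] := @exists_maximal_subring _ x^-1 z0; first by rewrite invrK.
have [[S1 SB SM Sz Sn] _] := Smax.
have Sx : ~ S x by move=> /Sn; rewrite mulVf // eqxx.
have [v hv vS] := valuation_ring_place S1 SB SM (fun y => maximal_valuation z0 y Smax) Sz
   (eq_ind_r (fun t => ~ S t) Sx (invrK x)).
have := hx v hv; rewrite vgeE // => h.
by apply: Sx; apply/vS.
Qed.

(** * Primitive elements and complex embeddings *)

Section Primitive.
Variable K : fieldExtType rat.
Implicit Types (x y t : K) (p q : {poly rat}).

Definition aeval t q : K := (map_poly (in_alg K) q).[t].

Lemma aevalD t p q : aeval t (p + q) = aeval t p + aeval t q.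
Proof. by rewrite /aeval rmorphD hornerD. Qed.
Lemma aevalB t p q : aeval t (p - q) = aeval t p - aeval t q.
Proof. by rewrite /aeval rmorphB hornerD hornerN. Qed.
Lemma aevalM t p q : aeval t (p * q) = aeval t p * aeval t q.
Proof. by rewrite /aeval rmorphM hornerM. Qed.
Lemma aevalC t c : aeval t c%:P = c *: 1.
Proof. by rewrite /aeval map_polyC hornerC. Qed.
Lemma aeval_comp t p q : aeval t (p \Po q) = aeval (aeval t q) p.
Proof. by rewrite /aeval map_comp_poly horner_comp. Qed.
Lemma aevalX t : aeval t 'X = t.
Proof. by rewrite /aeval map_polyX hornerX. Qed.

Lemma exists_aeval0 x : exists2 p, p != 0 & aeval x p = 0.
Proof.
have [n [[i ni] hn]] :=
  @int_relation K _ (fun i : 'I_(\dim {:K}).+1 => x ^+ i) (ltnSn _).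
exists (\poly_(i < (\dim {:K}).+1) (n (inord i))%:~R).
  apply/eqP => /polyP /(_ i); rewrite coef_poly ltn_ord coef0 inord_val.
  by move/eqP; rewrite intr_eq0 (negPf ni).
rewrite /aeval (@horner_coef_wide _ (\dim {:K}).+1); last first.
  by rewrite size_map_poly; exact: size_poly.
rewrite -[RHS]hn; apply: eq_bigr => j _; rewrite coef_map coef_poly ltn_ord inord_val.
by rewrite /= scaler_int.
Qed.

(** The primitive element theorem, applied to one element of s after the
    other. *)
Lemma primitive_seq (s : seq K) :
  exists t, forall b, b \in s -> exists q, aeval t q = b.
Proof.
elim: s => [|b s [t ht]]; first by exists 0.
have [p p0 pt] := exists_aeval0 t; have [r r0 rb] := exists_aeval0 b.
have pt' : root (map_poly (in_alg K) p) t by apply/rootP.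
have rb' : root (map_poly (in_alg K) r) b by apply/rootP.
have [n [[qt hqt] [qb hqb]]] := pchar0_PET p0 pt' r0 rb' (pchar_num _).
exists (b *+ n - t) => c; rewrite inE => /orP[/eqP ->|]; first by exists qb.
move=> /ht [q <-]; exists (q \Po qt).
by rewrite aeval_comp [aeval _ qt]hqt.
Qed.

Lemma primitive_integral : exists2 t, ringint t & forall x, exists q, aeval t q = x.
Proof.
have [t ht] := primitive_seq (vbasis {:K}).
have {}ht x : exists q, aeval t q = x.
  rewrite (coord_vbasis (memvf x)).
  elim/big_ind: _ => [|_ _ [p <-] [q <-]|i _].
  - by exists 0; rewrite /aeval rmorph0 horner0.
  - by exists (p + q); rewrite aevalD.
  have [q hq] : exists q, aeval t q = (vbasis {:K})`_i.
    by apply: ht; apply: mem_nth; rewrite size_tuple.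
  by exists ((coord (vbasis {:K}) i x)%:P * q); rewrite aevalM aevalC hq mulr_algl.
have [m m0 hm] := ringint_scale t; exists (m%:~R * t) => // x.
have [q <-] := ht x; exists (q \Po (m%:~R^-1 *: 'X)).
rewrite aeval_comp; congr (aeval _ q).
have mK : (m%:~R : rat) != 0 by rewrite intr_eq0.
rewrite -mul_polyC aevalM aevalC aevalX mulr_algl mulrzl -scaler_int scalerA.
by rewrite mulVf // scale1r.
Qed.

Variable t : K.
Hypothesis prim : forall x, exists q, aeval t q = x.

Lemma minpoly_exists : exists p, [/\ p \is monic, size p = (\dim {:K}).+1,
  separable_poly p, aeval t p = 0 & forall q, aeval t q = 0 -> p %| q].
Proof.
have /polyOver1P [p hp] := minPolyOver 1%VS t.
have full : <<1%VS; t>>%VS = {:K}%VS.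
  apply/eqP; rewrite eqEsubv subvf /=; apply/subvP => x _.
  have [q <-] := prim x; apply: mempx_Fadjoin.
  by apply/polyOver1P; exists q.
exists p; split.
- by have := monic_minPoly 1%VS t; rewrite hp map_monic.
- rewrite -(size_map_poly (in_alg K)) -hp size_minPoly.
  by rewrite -full dim_Fadjoin dimv1 muln1.
- rewrite -(separable_map (in_alg K)) -hp.
  by apply: pcharf0_separable; move=> n; rewrite pchar_lalg pchar_num.
- by rewrite /aeval -hp minPolyxx.
move=> q hq; rewrite -(dvdp_map (in_alg K)) -hp.
apply: minPoly_dvdp; first by apply/polyOver1P; exists q.
exact/rootP.
Qed.
End Primitive.

Section Embeddings.
Variables (R : realType) (K : fieldExtType rat).
Local Notation d := (\dim {:K}).

Lemma embedding_rmorph (s : K -> R[i]) : @embeddings R K s ->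
  exists f : {rmorphism K -> R[i]}, s = f.
Proof.
move=> [sB sM].
pose mB := GRing.isZmodMorphism.Build _ _ s sB.
pose mM := GRing.isMonoidMorphism.Build _ _ s sM.
pose f : {rmorphism K -> R[i]} := HB.pack s mB mM.
by exists f.
Qed.

Lemma rmorph_embedding (f : {rmorphism K -> R[i]}) : @embeddings R K f.
Proof.
split; first exact: raddfB.
by split; [exact: rmorph1|exact: rmorphM].
Qed.

Lemma rmorph_aeval (f : {rmorphism K -> R[i]}) t q :
  f (aeval t q) = (map_poly ratr q).[f t].
Proof.
rewrite /aeval -horner_map -map_poly_comp; congr (_.[_]).
by apply: eq_map_poly; apply: fmorph_eq_rat.
Qed.

(** K is Q[X]/(p) with p separable, so the embeddings correspond to the [K:Q]
    distinct complex roots of p: a value f(t) is sent to f(z), which does not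
    depend on the choice of f because p divides the difference of two choices.
    *)
Lemma embeddings_exist : exists2 t : K, ringint t &
  exists2 sig : 'I_d -> {rmorphism K -> R[i]},
    [/\ injective (fun i => sig i t) &
      forall s, @embeddings R K s -> exists i, s = sig i] &
    forall x : K, exists c : 'I_d -> rat, x = \sum_i c i *: t ^+ i.
Proof.
have [t ti prim] := primitive_integral K; exists t => //.
have [p [pm sp psep pt pdvd]] := minpoly_exists prim.
have [r hr] := closed_field_poly_normal (map_poly (ratr : rat -> R[i]) p).
rewrite (monicP _) ?map_monic // scale1r in hr.
have ur : uniq r by rewrite -separable_prod_XsubC -hr separable_map.
have sr : size r = d.
  by apply: succn_inj; rewrite -(size_prod_XsubC r id) -hr size_map_poly.
have ex (i : 'I_d) : exists f : {rmorphism K -> R[i]}, f t = r`_i.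
  pose z := r`_i.
  have pz : (map_poly (ratr : rat -> R[i]) p).[z] = 0.
    by apply/rootP; rewrite hr root_prod_XsubC mem_nth // sr.
  have [g hg] := choice prim.
  pose s x : R[i] := (map_poly ratr (g x)).[z].
  have sE q : s (aeval t q) = (map_poly ratr q).[z].
    have /dvdpP [u hu] : p %| g (aeval t q) - q.
      by apply: pdvd; rewrite aevalB hg subrr.
    apply/eqP; rewrite -subr_eq0 /s -hornerN -hornerD -rmorphB hu rmorphM hornerM pz.
    by rewrite mulr0.
  have [f hf] : exists f : {rmorphism K -> R[i]}, s = f.
    apply: embedding_rmorph; split.
      move=> x y; rewrite -(hg x) -(hg y) -aevalB !sE.
      by rewrite rmorphB hornerD hornerN.
    split.
      by rewrite -[1](scale1r (1 : K)) -(aevalC t) sE map_polyC hornerC /= rmorph1.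
    move=> x y; rewrite -(hg x) -(hg y) -aevalM !sE.
    by rewrite rmorphM hornerM.
  exists f; rewrite -hf -[t in LHS]aevalX sE map_polyX hornerX //.
have [sig hsig] := choice ex; exists sig; last first.
  move=> x; have [q <-] := prim x.
  rewrite (divp_eq q p) aevalD aevalM pt mulr0 add0r; set q' := q %% p.
  have sq : (size q' <= d)%N.
    by rewrite -ltnS -sp ltn_modp monic_neq0.
  exists (fun i => q'`_i); rewrite /aeval (@horner_coef_wide _ d) ?size_map_poly //.
  by apply: eq_bigr => i _; rewrite coef_map /= mulr_algl.
split.
  move=> i j; rewrite !hsig => /eqP; rewrite nth_uniq ?sr // => /eqP.
  exact: val_inj.
move=> s /embedding_rmorph [f ->].
have : f t \in r.
  rewrite -root_prod_XsubC -hr; apply/rootP.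
  by rewrite -rmorph_aeval pt rmorph0.
move=> fr; have ir : (index (f t) r < d)%N by rewrite -sr index_mem.
exists (Ordinal ir); apply/funext => x; have [q <-] := prim x.
by rewrite !rmorph_aeval hsig /= nth_index.
Qed.

End Embeddings.

(** * Norms and traces of algebraic integers *)

Section NormTrace.
Variables (R : realType) (K : fieldExtType rat).
Local Notation d := (\dim {:K}).
Local Notation abs := (@Normc.normc R).

Lemma normc_norm (z : R[i]) : `|z| = (abs z)%:C%C.
Proof. by case: z. Qed.

Lemma normc_ge0 (z : R[i]) : 0 <= abs z.
Proof. by rewrite -lecR -normc_norm normr_ge0. Qed.

Lemma normc_sum (I : Type) (r : seq I) (F : I -> R[i]) :
  abs (\sum_(i <- r) F i) <= \sum_(i <- r) abs (F i).
Proof.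
elim/big_ind2: _ => [|a b a' b' ha hb|//]; first by rewrite Normc.normc0.
by apply: le_trans (le_normcD _ _) _; apply: lerD.
Qed.

Lemma normc_int (n : int) : abs n%:~R = `|n|%:~R.
Proof.
by apply: complexI; rewrite -normc_norm -intr_norm rmorph_int.
Qed.

Lemma integral_rat_int (q : rat) :
  integralOver (intr : int -> R[i]) (ratr q) -> exists n : int, q = n%:~R.
Proof.
move=> [p pm pq].
have pq' : root (map_poly (intr : int -> rat) p) q.
  rewrite -(fmorph_root (ratr : rat -> R[i])) -map_poly_comp.
  by rewrite (eq_map_poly (g := intr)) // => n /=; rewrite ratr_int.
have qA : (ratr q : algC) \in Aint.
  apply: (@root_monic_Aint (map_poly intr p)).
  - rewrite (eq_map_poly (g := (ratr : rat -> algC) \o intr)) ?map_poly_comp ?fmorph_root //.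
    by move=> n /=; rewrite ratr_int.
  - exact: monic_map.
  by apply/polyOverP => i; rewrite coef_map /= intr_int.
have /intrP [n hn] := Cint_rat_Aint (Crat_rat q) qA.
by exists n; apply: (fmorph_inj (@ratr algC)); rewrite /= hn ratr_int.
Qed.

Lemma rmorph_integral (f : {rmorphism K -> R[i]}) x :
  ringint x -> integralOver (intr : int -> R[i]) (f x).
Proof.
move=> /ringint_integral [p pm px]; exists p => //.
rewrite (eq_map_poly (g := f \o intr)) ?map_poly_comp ?fmorph_root //.
by move=> n /=; rewrite rmorph_int.
Qed.

Variables (t : K) (sig : 'I_d -> {rmorphism K -> R[i]}).
Hypothesis ti : ringint t.
Hypothesis sig_inj : injective (fun i => sig i t).
Hypothesis span : forall x : K, exists c : 'I_d -> rat, x = \sum_i c i *: t ^+ i.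

Let V : 'M[R[i]]_d := Vandermonde d (\row_i sig i t).

Lemma vandermonde_unit : V \in unitmx.
Proof.
rewrite unitmxE unitfE det_Vandermonde; apply/prodf_neq0 => i _.
apply/prodf_neq0 => j ij; rewrite !mxE subr_eq0; apply/eqP => /sig_inj e.
by move: ij; rewrite e ltnn.
Qed.

Lemma rmorph_scale (f : {rmorphism K -> R[i]}) (c : rat) x : f (c *: x) = ratr c * f x.
Proof.
by rewrite -mulr_algl rmorphM; congr (_ * _); rewrite -(fmorph_eq_rat (f \o in_alg K)).
Qed.

(** The Vandermonde matrix of the conjugates of t diagonalises multiplication
    by x. This identifies the product and the sum of the conjugates of x with
    the determinant and the trace of a rational matrix. *)
Lemma multiplication_matrix x : exists M : 'M[rat]_d,
  V *m diag_mx (\row_i sig i x) = map_mx ratr M *m V.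
Proof.
(* Row j of the matrix holds the coordinates of t^j x. *)
have [c hc] := choice (fun j : 'I_d => span (t ^+ j * x)).
exists (\matrix_(j, k) c j k); apply/matrixP => j i.
rewrite mul_mx_diag !mxE -rmorphXn -rmorphM hc rmorph_sum.
by apply: eq_bigr => k _; rewrite !mxE rmorph_scale rmorphXn.
Qed.

Lemma dim_gt0 : (0 < d)%N.
Proof. by have := dimvS (subvf (1%VS : {vspace K})); rewrite dimv1. Qed.

(** The norm is a rational number and an algebraic integer. *)
Lemma prod_conjugates_int x : ringint x -> exists n : int, \prod_i sig i x = n%:~R.
Proof.
move=> hx; have [M hM] := multiplication_matrix x.
have e : \prod_i sig i x = ratr (\det M).
  have := congr1 determinant hM; rewrite !det_mulmx det_diag mulrC.
  move=> /mulIf; rewrite -unitfE -unitmxE vandermonde_unit => /(_ isT).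
  by under eq_bigr => i _ do rewrite mxE; rewrite det_map_mx.
have [|n hn] := @integral_rat_int (\det M).
  rewrite -e; apply: big_ind; first exact: mxpoly.integral1.
    by move=> a b; apply: integral_mul.
  by move=> i _; apply: rmorph_integral.
by exists n; rewrite e hn ratr_int.
Qed.

Lemma sum_conjugates_int x : ringint x -> exists n : int, \sum_i sig i x = n%:~R.
Proof.
move=> hx; have [M hM] := multiplication_matrix x.
have e : \sum_i sig i x = ratr (\tr M).
  have : diag_mx (\row_i sig i x) = invmx V *m (map_mx ratr M *m V).
    by rewrite -hM mulKmx // vandermonde_unit.
  move/(congr1 mxtrace); rewrite mxtrace_mulC mulmxK ?vandermonde_unit // mxtrace_diag.
  by under eq_bigr => i _ do rewrite mxE; rewrite trace_map_mx.
have [|n hn] := @integral_rat_int (\tr M).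
  rewrite -e; apply: big_ind; first exact: mxpoly.integral0.
    by move=> a b; apply: integral_add.
  by move=> i _; apply: rmorph_integral.
by exists n; rewrite e hn ratr_int.
Qed.

(** The norm of x is a nonzero integer, so its factors are not all smaller
    than 1. *)
Lemma exists_abs_ge1 x : ringint x -> x != 0 -> exists i, 1 <= abs (sig i x).
Proof.
move=> hx x0; have [n hn] := prod_conjugates_int hx.
apply: contrapT => H.
have lt1 i : `|sig i x| < 1.
  rewrite normc_norm -[1]/(1%:C%C) ltcR ltNge; apply/negP => h.
  by apply: H; exists i.
have n0 : n != 0.
  have : \prod_i sig i x != 0 by apply/prodf_neq0 => i _; rewrite fmorph_eq0.
  by rewrite hn intr_eq0.
have : `|\prod_i sig i x| < 1.
  rewrite normr_prod (bigD1 (Ordinal dim_gt0)) //=.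
  apply: le_lt_trans (lt1 (Ordinal dim_gt0)); rewrite ler_piMr //.
  by apply: prodr_ile1 => i _; rewrite normr_ge0 ltW.
rewrite hn -intr_norm ltrz1.
by case: n n0 {hn} => [[|n]|n].
Qed.

Lemma trace_nondegenerate x :
  (forall l : 'I_d, \sum_i sig i (t ^+ l * x) = 0) -> x = 0.
Proof.
move=> h.
have Vx : V *m \col_i sig i x = 0.
  apply/matrixP => l j; rewrite !mxE -[RHS](h l); apply: eq_bigr => i _.
  by rewrite !mxE rmorphM rmorphXn.
have := congr1 (mulmx (invmx V)) Vx; rewrite mulmx0 mulKmx ?vandermonde_unit //.
move=> /matrixP /(_ (Ordinal dim_gt0) 0); rewrite !mxE => /eqP.
by rewrite fmorph_eq0 => /eqP.
Qed.

(** The coordinates are L l x = Tr(t^l x). The trace form is nondegenerate,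
    integral on algebraic integers and bounded by the conjugates, so a linear
    equation with coefficients in the ring of integers of K amounts to [K:Q]
    integer equations of comparable size. *)
Lemma int_coordinates : exists2 C : R, 1 <= C & exists L : 'I_d -> K -> int,
  (forall l x (B : R), ringint x -> (forall i, abs (sig i x) <= B) ->
     `|L l x|%:~R <= C * B) /\
  forall (m : nat) (x : 'I_m -> K) (k : 'I_m -> int), (forall j, ringint (x j)) ->
    \sum_j (k j)%:~R * x j = 0 <-> forall l, \sum_j k j * L l (x j) = 0.
Proof.
pose C := 1 + \sum_(l < d) \sum_(i < d) abs (sig i (t ^+ l)).
have sumC0 (l : 'I_d) : 0 <= \sum_(i < d) abs (sig i (t ^+ l)).
  by apply: sumr_ge0 => i _; apply: normc_ge0.
exists C; first by rewrite lerDl sumr_ge0.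
have ex (p : 'I_d * K) : exists n : int, ringint p.2 ->
    \sum_i sig i (t ^+ p.1 * p.2) = n%:~R.
  have [h|h] := pselect (ringint p.2); last by exists 0.
  have [|n hn] := @sum_conjugates_int (t ^+ p.1 * p.2); last by exists n.
  by apply: ringintM => //; apply: ringintX.
have [L hL] := choice ex; exists (fun l x => L (l, x)); split.
  move=> l x B hx hB; have B0 : 0 <= B.
    exact: le_trans (normc_ge0 _) (hB (Ordinal dim_gt0)).
  rewrite -normc_int -(hL (l, x)) //=; apply: le_trans (normc_sum _ _) _.
  have Cl : \sum_(i < d) abs (sig i (t ^+ l)) <= C.
    by rewrite /C [X in _ <= 1 + X](bigD1 l) //= addrCA lerDl addr_ge0 // sumr_ge0.
  apply: le_trans (_ : (\sum_(i < d) abs (sig i (t ^+ l))) * B <= _); last first.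
    by apply: ler_wpM2r.
  rewrite mulr_suml; apply: ler_sum => i _; rewrite rmorphM Normc.normcM.
  by apply: ler_wpM2l => //; apply: normc_ge0.
move=> m x k hx.
have key (l : 'I_d) : \sum_i sig i (t ^+ l * \sum_j (k j)%:~R * x j) =
    (\sum_j k j * L (l, x j))%:~R.
  rewrite rmorph_sum /=; under eq_bigr => i _ do rewrite mulr_sumr rmorph_sum.
  rewrite exchange_big; apply: eq_bigr => j _.
  rewrite intrM -(hL (l, x j)) //= mulr_sumr; apply: eq_bigr => i _.
  by rewrite -(rmorph_int (sig i) (k j)) -rmorphM mulrCA.
split=> [h l|h].
  apply/eqP; rewrite -(intr_eq0 R[i]) -key h mulr0.
  by under eq_bigr => i _ do rewrite rmorph0; rewrite big1.
by apply: trace_nondegenerate => l; rewrite key h.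
Qed.

End NormTrace.

(** * The denominator ideal *)

Section FinitePart.
Variables (R : realType) (K : fieldExtType rat) (m n : nat) (A : 'M[K]_(m, n)).
Variables (i1 : 'I_m) (j1 : 'I_n).
Hypothesis A1 : A i1 j1 = 1.

Lemma max_entry_ge (nu : K -> R) i j : nu (A i j) <= max_entry nu A.
Proof. by have := le_bigmax 0 (fun ij => nu (A ij.1 ij.2)) (i, j). Qed.

Lemma finite_abs_ge0 (v : K -> int) (x : K) : 0 <= finite_abs R v x.
Proof.
by rewrite /finite_abs; case: ifP => // _; apply: exprz_ge0; apply: ler0n.
Qed.

(** The entry 1 forces the maximum to be at least 1, hence to be a nonnegative
    power of q, and it is attained. *)
Lemma max_entry_place (v : K -> int) : finite_places v -> exists k : nat,
  [/\ max_entry (finite_abs R v) A = (residue_card v)%:R ^+ k,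
      forall i j, vge v (- k%:Z) (A i j) &
      exists i j, A i j != 0 /\ v (A i j) = - k%:Z].
Proof.
move=> hv; set q : R := (residue_card v)%:R.
have q1 : 1 < q by rewrite /q ltr1n; apply: residue_card_gt1.
have [[i j] _ /= hij] := @eq_bigmax _ _ _ 0 (i1, j1) xpredT
  (fun ij => finite_abs R v (A ij.1 ij.2)) isT (fun _ _ => finite_abs_ge0 _ _).
rewrite -/(max_entry _ _) in hij.
have ge1 : 1 <= max_entry (finite_abs R v) A.
  have := max_entry_ge (finite_abs R v) i1 j1.
  by rewrite A1 /finite_abs oner_eq0 place1 // oppr0 expr0z.
have Aij : A i j != 0.
  by apply/eqP => e; move: ge1; rewrite hij /finite_abs e eqxx ler10.
have hmax : max_entry (finite_abs R v) A = q ^ (- v (A i j)).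
  by rewrite hij /finite_abs (negPf Aij).
have v0 : 0 <= - v (A i j).
  by rewrite -(ler_eXz2l q1) expr0z -hmax.
exists `|v (A i j)|%N.
have vk : (`|v (A i j)|%N : int) = - v (A i j) by rewrite abszE; lia.
split.
- by rewrite hmax exprnP vk.
- move=> i' j'; rewrite vk opprK.
  have [->|A0] := eqVneq (A i' j') 0; first by left.
  right; have := max_entry_ge (finite_abs R v) i' j'.
  by rewrite hmax /finite_abs (negPf A0) ler_eXz2l // lerN2.
by exists i, j; rewrite vk opprK.
Qed.

Lemma finite_max_support :
  finite_set ((@finite_places K) `&`
    (fun v => max_entry (finite_abs R v) A) @^-1` [set~ 1]).
Proof.
apply: (@sub_finite_set _ _ (\bigcup_(ij in [set ij : 'I_m * 'I_n | A ij.1 ij.2 != 0])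
   [set v | finite_places v /\ v (A ij.1 ij.2) != 0])).
  move=> v [hv /= h]; have [k [e _ [i [j [Aij vk]]]]] := max_entry_place hv.
  exists (i, j) => //; split => //=; rewrite vk oppr_eq0.
  by apply: contra_notN h; rewrite e; case: k {e vk} => // _; rewrite expr0.
apply: bigcup_finite; first exact: finite_finset.
by move=> ij Aij; apply: finite_place_support.
Qed.

(** The y such that y A has integral entries form the denominator ideal of A;
    at the place v it contains all y with v(y) at least k, where q^k is the
    local maximum. So its index in the ring of integers is at most the product
    of the local maxima. *)
Lemma finite_part_code : exists2 N : nat,
  \big[*%R/1]_(v \in @finite_places K) max_entry (finite_abs R v) A = N%:R &
  has_code (@ringint K) N (fun x y => forall i j, ringint ((x - y) * A i j)).
Proof.
rewrite fsbig_supp fsbig_finite; last exact: finite_max_support.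
set D := _ `&` _; set s := fset_set D.
have sP v : v \in s -> D v by rewrite in_fset_set ?inE //; exact: finite_max_support.
have ex v : exists k : nat, finite_places v ->
    max_entry (finite_abs R v) A = (residue_card v)%:R ^+ k /\
    forall i j, vge v (- k%:Z) (A i j).
  have [hv|hv] := pselect (finite_places v); last by exists 0%N.
  by have [k [h1 h2 _]] := max_entry_place hv; exists k.
have [k hk] := choice ex.
exists (\prod_(v <- s) residue_card v ^ k v)%N.
  rewrite natr_prod; apply: eq_big_seq => v /sP [hv _].
  by rewrite (hk v hv).1 natrX.
have codes : {in s, forall v, has_code (@ringint K) (residue_card v ^ k v)%N
    (fun x y => vge v (k v) (x - y))}.
  move=> v /sP [hv _]; apply: sub_code (residue_code hv (k v)) => // x hx.
  exact: hx.
apply: sub_code (code_all codes) => //.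
move=> x y hx hy h i j v hv.
have [vs|vs] := boolP (v \in s).
  rewrite -(subrr (k v : int)); apply: vgeM => //; first exact: h.
  exact: (hk v hv).2.
rewrite -[0]addr0; apply: vgeM => //; first by apply: (ringintB hx hy).
have : max_entry (finite_abs R v) A = 1.
  apply: contrapT => h1; move/negP: vs; apply.
  by rewrite in_fset_set ?inE //; exact: finite_max_support.
rewrite (hk v hv).1 => e; have := (hk v hv).2 i j.
suff -> : k v = 0%N by rewrite oppr0.
apply/eqP; rewrite -leqn0 leqNgt; apply/negP => k0.
have : (1 : R) < (residue_card v)%:R ^+ k v.
  by rewrite exprn_egt1 -?lt0n // ltr1n; apply: residue_card_gt1.
by rewrite e ltxx.
Qed.

End FinitePart.

(** * Small denominators *)

(** The index of the piece of length t that contains the value. *)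
Lemma code_interval (R : realType) (T : Type) (X : set T) (g : T -> R) (M t : R) :
  0 < t -> (forall x, X x -> `|g x| <= M) ->
  has_code X (Num.truncn (2 * M / t)).+1 (fun x y => `|g x - g y| <= t).
Proof.
move=> t0 hX; exists (fun x => Num.truncn ((g x + M) / t)).
have ge0 x : X x -> 0 <= (g x + M) / t.
  move=> /hX; rewrite ler_norml => /andP[h _].
  by rewrite divr_ge0 ?(ltW t0) //; lra.
split=> [x hx|x y hx hy e].
  rewrite ltnS; apply: le_truncn; rewrite ler_pM2r ?invr_gt0 //.
  by have := hX x hx; rewrite ler_norml => /andP[_ h]; lra.
have /andP[x1 x2] := truncn_itv (ge0 x hx).
have /andP[y1 y2] := truncn_itv (ge0 y hy).
rewrite e in x1 x2.
have -> : g x - g y = ((g x + M) / t - (g y + M) / t) * t.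
  by rewrite mulrBl !divfK ?gt_eqF //; ring.
rewrite normrM (gtr0_norm t0) ler_piMl ?(ltW t0) // ler_norml.
move: x1 x2 y1 y2; rewrite -!natr1; lra.
Qed.

Lemma truncn_half_le (R : realType) (y : R) :
  2 <= y -> (Num.truncn (y / 2)).+1%:R <= y.
Proof.
move=> y2; rewrite -natr1.
have /truncn_itv /andP[h _] : 0 <= y / 2 by lra.
by lra.
Qed.

Section SmallDenominator.
Variables (R : realType) (K : fieldExtType rat).
Local Notation d := (\dim {:K}).
Local Notation abs := (@Normc.normc R).
Variables (t : K) (sig : 'I_d -> {rmorphism K -> R[i]}).
Hypothesis ti : ringint t.
Hypothesis sig_inj : injective (fun i => sig i t).
Hypothesis sig_all : forall s, @embeddings R K s -> exists i, s = sig i.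
Hypothesis span : forall x : K, exists c : 'I_d -> rat, x = \sum_i c i *: t ^+ i.

Lemma sig_conj i : exists j, forall x, sig j x = (sig i x)^*%C.
Proof.
have /sig_all [j hj] := rmorph_embedding (conjc \o sig i).
by exists j => x; rewrite -[RHS]/((conjc \o sig i) x) hj.
Qed.

(** The conjugate embedding gives Re - Im in place of Re + Im. So these [K:Q]
    real coordinates determine the point, and real and complex embeddings need
    not be told apart. *)
Definition psi i x : R := complex.Re (sig i x) + complex.Im (sig i x).

Lemma psiB i x y : psi i (x - y) = psi i x - psi i y.
Proof.
rewrite /psi rmorphB; case: (sig i x) => a b; case: (sig i y) => a' b' /=.
by ring.
Qed.

Lemma psi0 i : psi i 0 = 0.
Proof. by rewrite /psi rmorph0 /= addr0. Qed.

Lemma psiD i x y : psi i (x + y) = psi i x + psi i y.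
Proof. by rewrite -[y in LHS]opprK psiB -[- y]sub0r psiB psi0; ring. Qed.

Lemma psi_natM i (k : nat) x : psi i (k%:R * x) = k%:R * psi i x.
Proof.
elim: k => [|k IH]; first by rewrite !mul0r psi0.
by rewrite -!natr1 !mulrDl !mul1r psiD IH.
Qed.

Lemma psi_sum i (I : Type) (r : seq I) (F : I -> K) :
  psi i (\sum_(j <- r) F j) = \sum_(j <- r) psi i (F j).
Proof.
elim/big_ind2: _ => [|x a y b <- <-|//]; [exact: psi0|exact: psiD].
Qed.

(** If j is the conjugate of i, then Re and Im are the half sum and the half
    difference of psi_i and psi_j. *)
Lemma abs_le_psi (e : 'I_d -> R) x :
  (forall i j, (forall y, sig j y = (sig i y)^*%C) -> e j = e i) ->
  (forall i, `|psi i x| <= e i) -> forall i, abs (sig i x) <= 2 * e i.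
Proof.
move=> e_conj he i; have [j hj] := sig_conj i.
have := he j; rewrite (e_conj _ _ hj) {1}/psi hj.
have := he i; rewrite {1}/psi.
case: (sig i x) => a b /=; rewrite !ler_norml => /andP[h1 h2] /andP[h3 h4].
have e0 : 0 <= e i by lra.
rewrite -[2 * e i]ger0_norm; last by lra.
rewrite -sqrtr_sqr ler_sqrt ?sqr_ge0 //.
have sq_le (z : R) : - e i <= z -> z <= e i -> z ^+ 2 <= e i ^+ 2.
  by move=> z1 z2; rewrite -subr_ge0 subr_sqr mulr_ge0; lra.
have ha : a ^+ 2 <= e i ^+ 2 by apply: sq_le; lra.
have hb : b ^+ 2 <= e i ^+ 2 by apply: sq_le; lra.
by have := sqr_ge0 (e i); rewrite exprMn; lra.
Qed.

Lemma prod_embeddings (F : (K -> R[i]) -> R) :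
  \big[*%R/1]_(s \in @embeddings R K) F s = \prod_i F (sig i).
Proof.
have -> : @embeddings R K = (fun i => sig i : K -> R[i]) @` [set: 'I_d].
  apply/seteqP; split=> [s /sig_all [i ->]|_ [i _ <-]]; first by exists i.
  exact: rmorph_embedding.
rewrite fsbig_image; last first.
  move=> i j _ _ e; apply: sig_inj; exact: (congr1 (fun f : K -> R[i] => f t) e).
apply: (fsbig_fwiden (index_enum 'I_d)).
- by move=> i _ /=; rewrite mem_index_enum.
- exact: index_enum_uniq.
by move=> i [_ /= []].
Qed.

Lemma power_combination_inj (c c' : 'I_d -> nat) :
  \sum_j (c j)%:R * t ^+ j = \sum_j (c' j)%:R * t ^+ j -> c =1 c'.
Proof.
move=> e j.
have h : (\row_j ((c j)%:R - (c' j)%:R)) *m Vandermonde d (\row_i sig i t) = 0.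
  apply/rowP => i; rewrite !mxE.
  under eq_bigr => l _ do rewrite !mxE mulrBl.
  rewrite sumrB; apply/eqP; rewrite subr_eq0; apply/eqP.
  have := congr1 (sig i) e; rewrite !rmorph_sum.
  under eq_bigr => l _ do rewrite rmorphM rmorph_nat rmorphXn.
  by under [RHS]eq_bigr => l _ do rewrite rmorphM rmorph_nat rmorphXn.
have := congr1 (mulmx^~ (invmx (Vandermonde d (\row_i sig i t)))) h.
rewrite mul0mx mulmxK; last exact: vandermonde_unit.
move=> /rowP /(_ j); rewrite !mxE => /eqP; rewrite subr_eq0 eqr_nat.
by move=> /eqP.
Qed.

(** The points are the combinations of 1, t, ..., t^(d-1) with coefficients in
    {0, ..., B}. Let m_l be the largest conjugate of an entry at the embedding
    l. The coordinate psi_l is cut into pieces of length e_l proportional to T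
    / m_l, and points are also separated modulo the denominator ideal, which
    takes N classes. For large B the number of cells is at most B^d (prod m_l)
    N / T^d <= B^d, by the bound on the height, and there are (B + 1)^d
    points; so two of them share a cell. For their difference delta, the
    conjugate of delta at l is at most 2 e_l, hence that of delta times any
    entry is O(T). Pieces of equal length would bound only the product of
    these conjugates over l, not each of them. *)
Lemma small_denominator : exists2 C : R, 0 < C &
  forall (m n : nat) (A : 'M[K]_(m, n)) (i1 : 'I_m) (j1 : 'I_n) (T : R),
  A i1 j1 = 1 -> 0 < T -> relative_height R A <= T ^+ d ->
  exists delta : K, [/\ delta != 0, forall i j, ringint (delta * A i j) &
    forall i j l, abs (sig l (delta * A i j)) <= C * T].
Proof.
pose C1 : R := 1 + \sum_(i < d) \sum_(j < d) `|psi i (t ^+ j)|.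
have sum0 (i : 'I_d) : 0 <= \sum_(j < d) `|psi i (t ^+ j)| by apply: sumr_ge0.
have C1_gt0 : 0 < C1 by rewrite ltr_pwDl // sumr_ge0.
exists (8 * C1); first by rewrite mulr_gt0.
move=> m n A i1 j1 T A1 T0 hT.
pose mx i : R := max_entry (arch_abs (sig i)) A.
have mx_ge i a b : abs (sig i (A a b)) <= mx i by exact: (max_entry_ge A (arch_abs (sig i))).
have mx1 i : 1 <= mx i by have := mx_ge i i1 j1; rewrite A1 rmorph1 Normc.normc1.
have mx0 i : 0 < mx i by apply: lt_le_trans (mx1 i).
have [N hN codeN] := finite_part_code R A1.
have hprod : (\prod_i mx i) * N%:R <= T ^+ d.
  by move: hT; rewrite /relative_height hN prod_embeddings.
(* As the largest conjugate m_i is at least 1, B >= 2 T gives B m_i / (2 T) >=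
   1, so that rounding up at most doubles the number of pieces. *)
pose B := (Num.truncn (2 * T)).+1.
have hB : 2 * T < B%:R by apply: truncnS_gt.
have B0 : (0 : R) < B%:R by rewrite ltr0n.
pose e i : R := 4 * C1 * T / mx i.
have e0 i : 0 < e i by rewrite divr_gt0 // !mulr_gt0.
pose X : set K := [set x | ringint x /\ forall i, `|psi i x| <= C1 * B%:R].
pose u i := (Num.truncn (2 * (C1 * B%:R) / e i)).+1.
have code_arch : has_code X (\prod_i u i)
    (fun x y => {in index_enum 'I_d, forall i, `|psi i x - psi i y| <= e i}).
  by apply: code_all => i _; apply: code_interval => // x [_].
have code_fin : has_code X N (fun x y => forall i j, ringint ((x - y) * A i j)).
  by apply: sub_code codeN => // x [].
have code := code_and code_arch code_fin.
pose P (f : {ffun 'I_d -> 'I_B.+1}) : K := \sum_j (f j)%:R * t ^+ j.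
have XP f : X (P f).
  split.
    apply: ringint_sum => j _; apply: ringintM; last exact: ringintX.
    by rewrite pmulrn; apply: ringint_int.
  move=> i; rewrite /P psi_sum; apply: le_trans (ler_norm_sum _ _ _) _.
  have Ci : \sum_(j < d) `|psi i (t ^+ j)| <= C1.
    by rewrite /C1 [X in _ <= 1 + X](bigD1 i) //= addrCA lerDl addr_ge0 // sumr_ge0.
  apply: le_trans (_ : (\sum_(j < d) `|psi i (t ^+ j)|) * B%:R <= _); last first.
    by apply: ler_wpM2r => //; apply: ltW.
  rewrite mulr_suml; apply: ler_sum => j _.
  rewrite psi_natM normrM normr_nat mulrC; apply: ler_wpM2l => //.
  by rewrite ler_nat -ltnS.
have [|f [g [fg [h1 h2]]]] := code_pigeonhole code XP.
  rewrite card_ffun !card_ord -(ltr_nat R) natrM natrX natr_prod.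
  have hu i : (u i)%:R <= mx i * (B%:R / T).
    have E : 2 * (C1 * B%:R) / e i = mx i * (B%:R / T) / 2.
      rewrite /e; field.
      by rewrite !gt_eqF.
    have BT : 2 <= B%:R / T by rewrite ler_pdivlMr // ltW.
    have ge2 : 2 <= mx i * (B%:R / T).
      by apply: le_trans BT _; rewrite ler_peMl // divr_ge0 ?ltW.
    by rewrite /u E; apply: truncn_half_le.
  have h3 : \prod_i ((u i)%:R : R) * N%:R <= \prod_i (mx i * (B%:R / T)) * N%:R.
    apply: ler_wpM2r => //; apply: ler_prod => i _; rewrite ler0n /=.
    exact: hu.
  apply: le_lt_trans h3 _; rewrite big_split /= prodr_const card_ord mulrAC.
  apply: le_lt_trans (_ : _ <= T ^+ d * (B%:R / T) ^+ d) _.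
    by apply: ler_wpM2r => //; rewrite exprn_ge0 // divr_ge0 ?ltW.
  rewrite -exprMn mulrC divfK ?gt_eqF //.
  by rewrite ltrXn2r ?ler0n ?ltr_nat // -lt0n dim_gt0.
have PB0 : P f - P g != 0.
  rewrite subr_eq0; apply: contra fg => /eqP /power_combination_inj efg.
  by apply/eqP/ffunP => j; apply/val_inj/efg.
exists (P f - P g); split => // a b l.
have hl : abs (sig l (P f - P g)) <= 2 * e l.
  apply: (@abs_le_psi e) => [i j hij|i]; last first.
    by rewrite psiB; apply: h1; rewrite mem_index_enum.
  rewrite /e /mx; congr (_ / _); rewrite /max_entry; apply: eq_bigr => ab _.
  by rewrite /arch_abs hij; case: (sig i _) => x y /=; rewrite sqrrN.
rewrite rmorphM Normc.normcM.
have -> : 8 * C1 * T = 2 * e l * mx l by rewrite /e; field; rewrite gt_eqF.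
by apply: ler_pM => //; apply: normc_ge0.
Qed.

End SmallDenominator.

(** * Relations between unitriangular matrices *)

Lemma ord3P (P : 'I_3 -> Prop) : P 0 -> P 1 -> P 2 -> forall i, P i.
Proof.
move=> P0 P1 P2 [[|[|[|i]]] hi] //.
- by rewrite (_ : Ordinal hi = 0) //; apply/val_inj.
- by rewrite (_ : Ordinal hi = 1) //; apply/val_inj.
by rewrite (_ : Ordinal hi = 2) //; apply/val_inj.
Qed.

Lemma sum3 (V : nmodType) (F : 'I_3 -> V) : \sum_i F i = F 0 + F 1 + F 2.
Proof.
rewrite !big_ord_recl big_ord0 addr0 addrA.
by congr (F _ + F _ + F _); apply/val_inj.
Qed.

Definition vec3 (T : Type) (x y z : T) (i : 'I_3) : T := nth z [:: x; y] i.

Section CrossProduct.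
Variable T : comNzRingType.
Implicit Types q r k : 'I_3 -> T.

Definition dot q k := \sum_j q j * k j.
Definition cross q r : 'I_3 -> T :=
  vec3 (q 1 * r 2 - q 2 * r 1) (q 2 * r 0 - q 0 * r 2) (q 0 * r 1 - q 1 * r 0).

Lemma dotE q k : dot q k = q 0 * k 0 + q 1 * k 1 + q 2 * k 2.
Proof. exact: sum3. Qed.

Lemma dotC q k : dot q k = dot k q.
Proof. by apply: eq_bigr => j _; rewrite mulrC. Qed.

(** The cross product of k with that of q and r is q (k.r) - r (k.q) = 0. *)
Lemma cross_parallel q r k : dot q k = 0 -> dot r k = 0 ->
  forall i j, k i * cross q r j = k j * cross q r i.
Proof.
rewrite !dotE => hq hr.
have e01 : k 0 * cross q r 1 = k 1 * cross q r 0.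
  rewrite /cross /vec3 /=; apply/eqP; rewrite -subr_eq0; apply/eqP.
  transitivity (q 2 * (r 0 * k 0 + r 1 * k 1 + r 2 * k 2) -
    r 2 * (q 0 * k 0 + q 1 * k 1 + q 2 * k 2)); first by ring.
  by rewrite hq hr !mulr0 subr0.
have e02 : k 0 * cross q r 2 = k 2 * cross q r 0.
  rewrite /cross /vec3 /=; apply/eqP; rewrite -subr_eq0; apply/eqP.
  transitivity (- q 1 * (r 0 * k 0 + r 1 * k 1 + r 2 * k 2) +
    r 1 * (q 0 * k 0 + q 1 * k 1 + q 2 * k 2)); first by ring.
  by rewrite hq hr !mulr0 addr0.
have e12 : k 1 * cross q r 2 = k 2 * cross q r 1.
  rewrite /cross /vec3 /=; apply/eqP; rewrite -subr_eq0; apply/eqP.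
  transitivity (q 0 * (r 0 * k 0 + r 1 * k 1 + r 2 * k 2) -
    r 0 * (q 0 * k 0 + q 1 * k 1 + q 2 * k 2)); first by ring.
  by rewrite hq hr !mulr0 subr0.
by apply: ord3P; apply: ord3P.
Qed.

End CrossProduct.

Section Heisenberg.
Variable K : fieldExtType rat.
Implicit Types a b c : K.

Lemma unitri3M a b c a' b' c' :
  unitri3 a b c *m unitri3 a' b' c' = unitri3 (a + a') (b + b') (c + c' + a * b').
Proof.
apply/matrixP => i j; rewrite mxE sum3 !mxE.
by elim/ord3P: i; elim/ord3P: j => /=; ring.
Qed.

Lemma unitri3_1 : unitri3 0 0 0 = 1%:M :> 'M[K]_3.
Proof.
by apply/matrixP => i j; rewrite !mxE; elim/ord3P: i; elim/ord3P: j.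
Qed.

Lemma unitri3_eq1 a b c : unitri3 a b c = 1%:M <-> [/\ a = 0, b = 0 & c = 0].
Proof.
rewrite -unitri3_1; split=> [/matrixP h|[-> -> ->] //].
by have := h 0 1; have := h 1 2; have := h 0 2; rewrite !mxE /= => -> -> ->.
Qed.

(** The s-th power for an arbitrary scalar s; with s (s - 1) / 2 in the corner
    it is a homomorphism in s, which covers negative exponents together with
    positive ones. *)
Definition unitri3_power a b c (s : K) : 'M[K]_3 :=
  unitri3 (s * a) (s * b) (s * c + s * (s - 1) / 2 * (a * b)).

Lemma unitri3_powerD a b c s s' :
  unitri3_power a b c s *m unitri3_power a b c s' = unitri3_power a b c (s + s').
Proof.
have h2 : (2 : K) != 0 by rewrite (pmulrn 1 2) intr_fieldExt_eq0.
rewrite /unitri3_power unitri3M; congr unitri3; try by ring.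
by field.
Qed.

Lemma unitri3X a b c (k : int) : unitri3 a b c ^ k = unitri3_power a b c k%:~R.
Proof.
have nat_case (n : nat) : unitri3 a b c ^+ n = unitri3_power a b c n%:R.
  elim: n => [|n IH].
    by rewrite expr0 /unitri3_power !mul0r addr0 unitri3_1.
  rewrite exprS IH -natr1 addrC -unitri3_powerD; congr (_ * _).
  by rewrite /unitri3_power !mul1r subrr !mul0r addr0.
case: k => n; first by rewrite -exprnP nat_case.
rewrite NegzE -exprnN nat_case mulrNz -pmulrn.
have h s : unitri3_power a b c s * unitri3_power a b c (- s) = 1.
  by rewrite -[LHS]/(_ *m _) unitri3_powerD subrr /unitri3_power !mul0r addr0 unitri3_1.
set s := n.+1%:R.
have us : unitri3_power a b c s \is a GRing.unit.
  apply/unitrP; exists (unitri3_power a b c (- s)); split => //.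
  by rewrite -{2}[s]opprK.
by apply: (mulrI us); rewrite mulrV // h.
Qed.

(** The relation between the A_i, read off from the logarithms of the matrices
    by the Baker-Campbell-Hausdorff formula; g_i stands for twice the corner
    entry of log A_i, which is 2 c_i - a_i b_i. *)
Definition heisenberg_relation (a b g : 'I_3 -> K) (k : 'I_3 -> int) : Prop :=
  let kK i : K := (k i)%:~R in
  [/\ dot kK a = 0, dot kK b = 0 &
      dot kK g +
        (kK 0 * kK 1 * (a 0 * b 1 - a 1 * b 0) +
         kK 0 * kK 2 * (a 0 * b 2 - a 2 * b 0) +
         kK 1 * kK 2 * (a 1 * b 2 - a 2 * b 1)) = 0].

(** Twice the corner entry of the product, minus the product of the first two
    sums, is the third expression. *)
Lemma unitri3_prod_eq1 (a b c : 'I_3 -> K) (k : 'I_3 -> int) :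
  let A i := unitri3 (a i) (b i) (c i) in
  A 0 ^ k 0 *m A 1 ^ k 1 *m A 2 ^ k 2 = 1%:M <->
  heisenberg_relation a b (fun i => 2 * c i - a i * b i) k.
Proof.
move=> A; rewrite /heisenberg_relation; set kK := fun i => (k i)%:~R : K.
rewrite !unitri3X /unitri3_power !unitri3M unitri3_eq1.
have h2 : (2 : K) != 0 by rewrite (pmulrn 1 2) intr_fieldExt_eq0.
set e := (X in [/\ _, _ & X = 0]); rewrite !dotE.
have -> : kK 0 * (2 * c 0 - a 0 * b 0) + kK 1 * (2 * c 1 - a 1 * b 1) +
    kK 2 * (2 * c 2 - a 2 * b 2) +
    (kK 0 * kK 1 * (a 0 * b 1 - a 1 * b 0) +
     kK 0 * kK 2 * (a 0 * b 2 - a 2 * b 0) +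
     kK 1 * kK 2 * (a 1 * b 2 - a 2 * b 1)) =
    2 * e - (kK 0 * a 0 + kK 1 * a 1 + kK 2 * a 2) *
      (kK 0 * b 0 + kK 1 * b 1 + kK 2 * b 2).
  by rewrite /e /kK; field.
split=> -[-> -> h]; split => //; first by rewrite h mulr0 mul0r subr0.
by move/eqP: h; rewrite mul0r subr0 mulf_eq0 (negPf h2) => /eqP.
Qed.

End Heisenberg.

(** * Small solutions of integer systems *)

Section IntegerSystem.
Implicit Types (q r k : 'I_3 -> int).

(** The given solution without zero entries rules out that q has exactly one
    nonzero entry; for every other pattern of zeros a solution can be written
    down. *)
Lemma small_orthogonal_vector q k (Y : int) : (forall j, `|q j| <= Y) -> 1 <= Y ->
  (exists j, q j != 0) -> (forall j, k j != 0) -> dot q k = 0 ->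
  exists k', [/\ forall j, k' j != 0, forall j, `|k' j| <= 2 * Y & dot q k' = 0].
Proof.
move=> qY Y1 [j qj] k0; rewrite dotE => e.
have := qY 0; have := qY 1; have := qY 2 => h2 h1 h0.
have := k0 0; have := k0 1; have := k0 2 => /eqP k2 /eqP k1 /eqP k0'.
have nz : [|| q 0 != 0, q 1 != 0 | q 2 != 0].
  by elim/ord3P: j qj => ->; rewrite ?orbT.
have [q0|q0] := eqVneq (q 0) 0.
  have [q1|q1] := eqVneq (q 1) 0.
    by move: nz e; rewrite q0 q1 /= !mul0r !add0r => nz /eqP; rewrite mulf_eq0 (negPf nz) => /eqP.
  have [q2|q2] := eqVneq (q 2) 0.
    by move: e; rewrite q0 q2 !mul0r add0r addr0 => /eqP; rewrite mulf_eq0 (negPf q1) => /eqP.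
  exists (vec3 1 (q 2) (- q 1)); rewrite dotE /=; split.
  - by apply: ord3P; rewrite /vec3 /= ?oppr_eq0.
  - by apply: ord3P; rewrite /vec3 /= ?normrN; lia.
  by rewrite q0 /vec3 /=; ring.
have [q1|q1] := eqVneq (q 1) 0.
  have [q2|q2] := eqVneq (q 2) 0.
    by move: e; rewrite q1 q2 !mul0r !addr0 => /eqP; rewrite mulf_eq0 (negPf q0) => /eqP.
  exists (vec3 (q 2) 1 (- q 0)); rewrite dotE /=; split.
  - by apply: ord3P; rewrite /vec3 /= ?oppr_eq0.
  - by apply: ord3P; rewrite /vec3 /= ?normrN; lia.
  by rewrite q1 /vec3 /=; ring.
have [q2|q2] := eqVneq (q 2) 0.
  exists (vec3 (q 1) (- q 0) 1); rewrite dotE /=; split.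
  - by apply: ord3P; rewrite /vec3 /= ?oppr_eq0.
  - by apply: ord3P; rewrite /vec3 /= ?normrN; lia.
  by rewrite q2 /vec3 /=; ring.
(* The sign makes the middle entry s q_2 - q_0 nonzero. *)
pose s : int := if q 0 == q 2 then -1 else 1.
have s_abs : s = 1 \/ s = -1 by rewrite /s; case: ifP; [right|left].
exists (vec3 (q 1) (s * q 2 - q 0) (- s * q 1)); rewrite dotE /=; split.
- apply: ord3P; rewrite /vec3 //=.
    by rewrite /s; case: (q 0 =P q 2) => h; lia.
  by rewrite mulf_neq0 // oppr_eq0 /s; case: ifP.
- by apply: ord3P; rewrite /vec3 /=; case: s_abs => s1; rewrite ?s1; lia.
by rewrite /vec3 /=; ring.
Qed.

(** If two rows are independent, all solutions are multiples of their cross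
    product, which therefore has no zero entry and solves the system itself.
    If all rows are proportional, a single equation remains. *)
Lemma small_full_solution (I : Type) (M : I -> 'I_3 -> int) (Y : int) k :
  (forall i j, `|M i j| <= Y) -> 1 <= Y ->
  (forall j, k j != 0) -> (forall i, dot (M i) k = 0) ->
  exists k', [/\ forall j, k' j != 0, forall j, `|k' j| <= 2 * Y ^+ 2 &
    forall i, dot (M i) k' = 0].
Proof.
move=> MY Y1 k0 Mk.
have Y2 : Y <= Y ^+ 2 by rewrite expr2; nia.
have [[i [j Mij]]|zero] := pselect (exists i j, M i j != 0); last first.
  exists (fun=> 1); split => // i; first by rewrite normr1; lia.
  rewrite /dot big1 // => j _; apply/eqP; rewrite mulf_eq0; apply/orP; left.
  by apply: contrapT => /negP h; apply: zero; exists i, j.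
have [[i' [j' w0]]|par] := pselect (exists i' j', cross (M i) (M i') j' != 0).
  have pk := cross_parallel (Mk i) (Mk i'); set w := cross _ _ in w0 pk.
  exists w; split => [l|l|i''].
  - apply: contra w0 => /eqP wl; have := pk l j'; rewrite wl mulr0 => /eqP.
    by rewrite mulf_eq0 (negPf (k0 l)).
  - have bnd (x y z t : int) : `|x| <= Y -> `|y| <= Y -> `|z| <= Y -> `|t| <= Y ->
        `|x * y - z * t| <= 2 * Y ^+ 2.
      move=> hx hy hz ht; apply: le_trans (ler_normB _ _) _.
      by rewrite !normrM expr2; nia.
    by elim/ord3P: l; apply: bnd.
  apply: (mulfI (k0 0)); rewrite mulr0 /dot mulr_sumr.
  under eq_bigr => l _ do rewrite mulrCA pk mulrA.
  by rewrite -mulr_suml -/(dot _ _) Mk mul0r.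
have [k' [k'0 k'Y hk']] := small_orthogonal_vector (MY i) Y1 (ex_intro _ j Mij) k0 (Mk i).
exists k'; split => // [l|i']; first by apply: le_trans (k'Y l) _; lia.
have par0 l : cross (M i) (M i') l = 0.
  by apply/eqP; apply: contrapT => /negP h; apply: par; exists i', l.
have prop l l' : M i l * M i' l' = M i' l * M i l'.
  have := par0 0; have := par0 1; have := par0 2; rewrite /cross /vec3 /=.
  by move: l l'; apply: ord3P; apply: ord3P; lia.
apply: (mulfI Mij); rewrite mulr0 /dot mulr_sumr.
under eq_bigr => l _ do rewrite mulrA prop -mulrA.
by rewrite -mulr_sumr -/(dot _ _) hk' mulr0.
Qed.

End IntegerSystem.

(** * Small exponents *)

Section Core.
Variables (R : realType) (K : fieldExtType rat).
Local Notation d := (\dim {:K}).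
Local Notation abs := (@Normc.normc R).
Variables (t : K) (sig : 'I_d -> {rmorphism K -> R[i]}).
Hypothesis ti : ringint t.
Hypothesis sig_inj : injective (fun i => sig i t).
Hypothesis span : forall x : K, exists c : 'I_d -> rat, x = \sum_i c i *: t ^+ i.

(** An algebraic integer of house at most B. *)
Definition int_bounded (x : K) (B : R) := ringint x /\ forall l, abs (sig l x) <= B.

Lemma int_boundedM x y B B' : int_bounded x B -> int_bounded y B' ->
  int_bounded (x * y) (B * B').
Proof.
move=> [hx bx] [hy yB]; split; first exact: ringintM.
move=> l; rewrite rmorphM Normc.normcM.
by apply: ler_pM => //; apply: normc_ge0.
Qed.

Lemma int_boundedD x y B B' : int_bounded x B -> int_bounded y B' ->
  int_bounded (x + y) (B + B').
Proof.
move=> [hx bx] [hy yB]; split; first exact: ringintD.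
move=> l; rewrite rmorphD; apply: le_trans (le_normcD _ _) _.
exact: lerD.
Qed.

Lemma int_boundedN x B : int_bounded x B -> int_bounded (- x) B.
Proof.
move=> [hx bx]; split; first by rewrite -sub0r; apply: ringintB => //; exact: ringint0.
by move=> l; rewrite rmorphN normcN.
Qed.

Lemma int_boundedB x y B B' : int_bounded x B -> int_bounded y B' ->
  int_bounded (x - y) (B + B').
Proof. by move=> hx /int_boundedN; apply: int_boundedD. Qed.

Lemma int_bounded_le x B B' : B <= B' -> int_bounded x B -> int_bounded x B'.
Proof. by move=> BB [hx bx]; split => // l; apply: le_trans (bx l) BB. Qed.

Lemma int_bounded_int (n : int) : int_bounded n%:~R `|n|%:~R.
Proof.
by split; [apply: ringint_int|move=> l; rewrite rmorph_int normc_int].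
Qed.

(** Some conjugate of u has absolute value at least 1. *)
Lemma int_le_of_mul (k : int) (u g : K) (B : R) : ringint u -> u != 0 ->
  k%:~R * u = g -> (forall l, abs (sig l g) <= B) -> `|k|%:~R <= B.
Proof.
move=> hu u0 e hg; have [l ul] := exists_abs_ge1 sig_inj span hu u0.
apply: le_trans (hg l); rewrite -e rmorphM rmorph_int Normc.normcM normc_int.
by rewrite ler_peMr // ler0z.
Qed.

Section Bounded.
Variables (X : R) (a b g : 'I_3 -> K).
Hypothesis ha : forall i, int_bounded (a i) X.
Hypothesis hb : forall i, int_bounded (b i) X.
Hypothesis hg : forall i, int_bounded (g i) (3 * X ^+ 2).

Lemma cross_bounded i : int_bounded (cross a b i) (2 * X ^+ 2).
Proof.
have h x y z u : int_bounded x X -> int_bounded y X -> int_bounded z X ->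
    int_bounded u X -> int_bounded (x * y - z * u) (2 * X ^+ 2).
  move=> hx hy hz hu; apply: int_bounded_le (int_boundedB (int_boundedM hx hy) (int_boundedM hz hu)).
  by rewrite expr2; lra.
by elim/ord3P: i; apply: h.
Qed.

(** As k is proportional to w = cross a b, the last equation can be solved for
    the factor: k_i w_j w_l = - w.g for {i, j, l} = {0, 1, 2}. *)
Lemma rigid_bound k : (forall i, k i != 0) -> heisenberg_relation a b g k ->
  (exists i, cross a b i != 0) -> forall i, `|k i|%:~R <= 18 * X ^+ 4.
Proof.
move=> k0 [ea eb eg] [j wj].
have par := cross_parallel (etrans (dotC _ _) ea) (etrans (dotC _ _) eb).
set w := cross a b in wj par.
have kK0 i : (k i)%:~R != 0 :> K by rewrite intr_fieldExt_eq0.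
have w0 i : w i != 0.
  apply: contra wj => /eqP wi; have := par i j; rewrite wi mulr0 => /eqP.
  by rewrite mulf_eq0 (negPf (kK0 i)).
pose G := - (w 0 * g 0 + w 1 * g 1 + w 2 * g 2).
have hG : int_bounded G (18 * X ^+ 4).
  have h i : int_bounded (w i * g i) (6 * X ^+ 4).
    apply: int_bounded_le (int_boundedM (cross_bounded i) (hg i)).
    by rewrite (_ : 2 * X ^+ 2 * (3 * X ^+ 2) = 6 * X ^+ 4) //; ring.
  apply: int_boundedN; apply: int_bounded_le (int_boundedD (int_boundedD (h 0) (h 1)) (h 2)).
  by rewrite -!mulrDl (_ : (6 + 6 + 6 : R) = 18) //; ring.
have eG : (k 0)%:~R * (w 1 * w 2) = G.
  have /eqP := par 0 1; rewrite -subr_eq0 => /eqP e1.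
  have /eqP := par 0 2; rewrite -subr_eq0 => /eqP e2.
  apply: (mulIf (kK0 0)); apply/eqP; rewrite -subr_eq0; apply/eqP.
  move: eg; rewrite dotE /G.
  have -> : a 0 * b 1 - a 1 * b 0 = w 2 by [].
  have -> : a 0 * b 2 - a 2 * b 0 = - w 1 by rewrite /w /cross /vec3 /=; ring.
  have -> : a 1 * b 2 - a 2 * b 1 = w 0 by [].
  move=> eg.
  (* Up to multiples of k_0 w_1 - k_1 w_0 = 0 and k_0 w_2 - k_2 w_0 = 0, the
     difference is w_0 times the last equation. *)
  transitivity (w 0 * ((k 0)%:~R * g 0 + (k 1)%:~R * g 1 + (k 2)%:~R * g 2 +
      ((k 0)%:~R * (k 1)%:~R * w 2 + (k 0)%:~R * (k 2)%:~R * - w 1 +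
       (k 1)%:~R * (k 2)%:~R * w 0)) +
    ((k 0)%:~R * w 1 - (k 1)%:~R * w 0) *
      (g 1 + (k 0)%:~R * w 2 + (k 2)%:~R * w 0) +
    ((k 0)%:~R * w 2 - (k 2)%:~R * w 0) * g 2); first by ring.
  by rewrite eg e1 e2 mulr0 !mul0r !addr0.
have wR i : ringint (w i) := (cross_bounded i).1.
have bound (i : 'I_3) (u u' : 'I_3) :
    (k i)%:~R * (w u * w u') = G -> `|k i|%:~R <= 18 * X ^+ 4.
  by move=> e; apply: (int_le_of_mul _ _ e hG.2); [apply: ringintM|rewrite mulf_neq0].
apply: ord3P; first exact: (bound 0 1 2).
  by apply: (bound 1 0 2); rewrite -eG !mulrA (par 1 0).
by apply: (bound 2 0 1); rewrite -eG !mulrA (par 2 0) mulrAC.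
Qed.

End Bounded.

(** If a and b are not proportional, the given exponents are bounded
    themselves. Otherwise the quadratic terms vanish and a linear system over
    K is left, which the trace coordinates turn into an integer system. *)
Lemma small_heisenberg_relation : exists2 C : R, 0 < C &
  forall (X : R) (a b g : 'I_3 -> K) (k : 'I_3 -> int), 1 <= X ->
    (forall i, int_bounded (a i) X) -> (forall i, int_bounded (b i) X) ->
    (forall i, int_bounded (g i) (3 * X ^+ 2)) ->
    (forall i, k i != 0) -> heisenberg_relation a b g k ->
  exists k', [/\ forall i, k' i != 0, forall i, `|k' i|%:~R <= C * X ^+ 4 &
    heisenberg_relation a b g k'].
Proof.
have [C C1 [L [Lbound Lrel]]] := int_coordinates ti sig_inj span.
have C18 : 18 <= 18 * C ^+ 2 by rewrite ler_peMr // exprn_ege1.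
exists (18 * C ^+ 2); first by apply: lt_le_trans C18.
move=> X a b g k X1 ha hb hg k0 hk.
have X4 : 0 <= X ^+ 4 by rewrite exprn_ge0 // (le_trans _ X1).
have [W|W] := pselect (exists i, cross a b i != 0).
  exists k; split => // i; apply: le_trans (rigid_bound ha hb hg k0 hk W i) _.
  exact: ler_wpM2r.
have w0 i : cross a b i = 0.
  by apply/eqP; apply: contrapT => /negP h; apply: W; exists i.
have quad k' : heisenberg_relation a b g k' <->
    [/\ \sum_i (k' i)%:~R * a i = 0, \sum_i (k' i)%:~R * b i = 0 &
        \sum_i (k' i)%:~R * g i = 0].
  rewrite /heisenberg_relation.
  have -> : a 0 * b 1 - a 1 * b 0 = 0 by exact: (w0 2).
  have -> : a 0 * b 2 - a 2 * b 0 = 0.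
    by rewrite -[LHS]opprK opprB; have := w0 1; rewrite /cross /vec3 /= => ->; rewrite oppr0.
  have -> : a 1 * b 2 - a 2 * b 1 = 0 by exact: (w0 0).
  by rewrite !mulr0 !addr0.
pose x (r : 'I_3) : 'I_3 -> K := vec3 a b g r.
have hx r j : int_bounded (x r j) (3 * X ^+ 2).
  have hX : X <= 3 * X ^+ 2 by rewrite expr2; nra.
  by elim/ord3P: r; rewrite /x /vec3 //=; apply: int_bounded_le hX _.
pose M (rl : 'I_3 * 'I_d) j : int := L rl.2 (x rl.1 j).
have sys k' : heisenberg_relation a b g k' <-> forall rl, dot (M rl) k' = 0.
  rewrite quad.
  have key r : \sum_i (k' i)%:~R * x r i = 0 <-> forall l, dot (M (r, l)) k' = 0.
    rewrite (Lrel _ (x r) k'); last by move=> j; case: (hx r j).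
    split=> h l; rewrite -[RHS](h l); apply: eq_bigr => j _; exact: mulrC.
  split=> [[h0 h1 h2] [r l]|h].
    by move: l; apply/key; elim/ord3P: r.
  by split; [apply/(key 0)|apply/(key 1)|apply/(key 2)] => l; apply: h.
pose Y := Num.floor (C * (3 * X ^+ 2)).
have YR : Y%:~R <= C * (3 * X ^+ 2) by apply: floor_le.
have MY rl j : `|M rl j| <= Y.
  by rewrite floor_ge_int; apply: Lbound; case: (hx rl.1 j).
have Y1 : 1 <= Y.
  have X2 : 1 <= X ^+ 2 by rewrite exprn_ege1.
  by rewrite floor_ge_int; apply: mulr_ege1 => //; lra.
have [k' [k'0 k'Y hk']] := small_full_solution MY Y1 k0 ((sys k).1 hk).
exists k'; split => // [i|]; last exact/sys.
apply: le_trans (_ : (2 * Y ^+ 2)%:~R <= _); first by rewrite ler_int.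
rewrite intrM rmorphXn /=.
rewrite (_ : 18 * C ^+ 2 * X ^+ 4 = 2 * (C * (3 * X ^+ 2)) ^+ 2); last by ring.
rewrite ler_pM2l // lerXn2r ?nnegrE ?ler0z //; first by lia.
by apply: le_trans YR; rewrite ler0z; lia.
Qed.

End Core.

Lemma heisenberg_relation_scale (K : fieldExtType rat) (e : K) (a b g : 'I_3 -> K)
    (k : 'I_3 -> int) : e != 0 ->
  heisenberg_relation (fun i => e * a i) (fun i => e * b i) (fun i => e ^+ 2 * g i) k <->
  heisenberg_relation a b g k.
Proof.
move=> e0; rewrite /heisenberg_relation !dotE.
set p := (X in [/\ X = 0, _ & _] <-> _); set q := (X in [/\ _, X = 0 & _] <-> _).
set r := (X in [/\ _, _ & X = 0] <-> _).
set p' := (X in _ <-> [/\ X = 0, _ & _]); set q' := (X in _ <-> [/\ _, X = 0 & _]).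
set r' := (X in _ <-> [/\ _, _ & X = 0]).
have -> : p = e * p' by rewrite /p /p'; ring.
have -> : q = e * q' by rewrite /q /q'; ring.
have -> : r = e ^+ 2 * r' by rewrite /r /r'; ring.
have zero x (n : nat) : e ^+ n * x = 0 <-> x = 0.
  split=> [/eqP|->]; last by rewrite mulr0.
  by rewrite mulf_eq0 expf_eq0 (negPf e0) andbF => /eqP.
by rewrite -[e in e * p']expr1 -[e in e * q']expr1; split=> -[/zero ? /zero ? /zero ?];
  split => //; apply/zero.
Qed.

Lemma relative_height_le (R : realType) (K : fieldExtType rat) (m n : nat)
    (A : 'M[K]_(m, n)) (T : R) : 0 <= T ->
  weil_height R A <= T -> relative_height R A <= T ^+ \dim {:K}.
Proof.
move=> T0 hT.
have max_ge0 nu : 0 <= max_entry nu A by apply: bigmax_ge_id.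
have rel_ge0 : 0 <= relative_height R A.
  by apply: mulr_ge0; apply: prodr_ge0 => ? _; apply: max_ge0.
have d0 : (\dim {:K})%:R != 0 :> R by rewrite pnatr_eq0 -lt0n dim_gt0.
rewrite -[relative_height R A]powRr1 // -[X in _ `^ X](mulVf d0) powRrM powR_mulrn ?powR_ge0 //.
by rewrite lerXn2r ?nnegrE ?powR_ge0.
Qed.

Theorem theorem7 (R : realType) (K : fieldExtType rat) (c0 : R) (hc0 : 0 < c0) :
  exists2 C : R, 0 < C &
    forall (H : R) (a b c : 'I_3 -> K),
      1 <= H ->
      let A (i : 'I_3) : 'M[K]_3 := unitri3 (a i) (b i) (c i) in
      (forall i, weil_height R (A i) <= c0 * H) ->
      (exists k : 'I_3 -> int,
        (forall i, k i != 0) /\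
        A 0 ^ k 0 *m A 1 ^ k 1 *m A 2 ^ k 2 = 1%:M) ->
      exists k : 'I_3 -> int,
        [/\ forall i, k i != 0,
            forall i, `|k i|%:~R <= C * H ^+ 58 &
            A 0 ^ k 0 *m A 1 ^ k 1 *m A 2 ^ k 2 = 1%:M].
Proof.
have [t ti [sig [sig_inj sig_all] span]] := embeddings_exist R K.
have [C C_gt0 small] := small_denominator ti sig_inj sig_all.
have [C' C'_gt0 bound] := small_heisenberg_relation ti sig_inj span.
(* With D >= 1 the common bound D H is at least 1, so that its powers
   increase. *)
pose D := Num.max 1 (C * c0).
have D1 : 1 <= D by rewrite le_max lexx.
have D_gt0 : 0 < D by apply: lt_le_trans D1.
exists (C' * D ^+ 12); first by rewrite mulr_gt0 ?exprn_gt0.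
move=> H a b c H1 A hA [k [k0 hk]].
have H_gt0 : 0 < H by apply: lt_le_trans H1.
have DH1 : 1 <= D * H by apply: mulr_ege1.
have ex i : exists e : K, e != 0 /\ [/\ int_bounded sig e (D * H),
    int_bounded sig (e * a i) (D * H), int_bounded sig (e * b i) (D * H) &
    int_bounded sig (e * c i) (D * H)].
  have T_gt0 : 0 < c0 * H by rewrite mulr_gt0.
  have A1 : A i 0 0 = 1 by rewrite mxE.
  have [e [e0 eint ebound]] :=
    small 3 3 (A i) 0 0 (c0 * H) A1 T_gt0 (relative_height_le (ltW T_gt0) (hA i)).
  have entry u w : int_bounded sig (e * A i u w) (D * H).
    split=> // l; apply: le_trans (ebound u w l) _.
    by rewrite mulrA ler_pM2r // le_max lexx orbT.
  exists e; split => //; split.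
  - by have := entry 0 0; rewrite A1 mulr1.
  - by have := entry 0 1; rewrite mxE.
  - by have := entry 1 2; rewrite mxE.
  by have := entry 0 2; rewrite mxE.
have [e he] := choice ex.
(* One denominator for all three matrices, at the price of D H becoming its
   cube. *)
pose E := e 0 * e 1 * e 2.
have E0 : E != 0 by rewrite !mulf_neq0 //; case: (he 0) (he 1) (he 2) => ? _ [? _] [].
pose X := (D * H) ^+ 3.
have X1 : 1 <= X by rewrite exprn_ege1.
have scale (x : 'I_3 -> K) : (forall i, int_bounded sig (e i * x i) (D * H)) ->
    forall i, int_bounded sig (E * x i) X.
  move=> hx i; have eb j : int_bounded sig (e j) (D * H) by case: (he j) => _ [].
  have -> : X = D * H * (D * H) * (D * H) by rewrite /X; ring.
  elim/ord3P: i.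
  - have -> : E * x 0 = e 0 * x 0 * e 1 * e 2 by rewrite /E; ring.
    by do 2!apply: int_boundedM => //.
  - have -> : E * x 1 = e 1 * x 1 * e 0 * e 2 by rewrite /E; ring.
    by do 2!apply: int_boundedM => //.
  have -> : E * x 2 = e 2 * x 2 * e 0 * e 1 by rewrite /E; ring.
  by do 2!apply: int_boundedM => //.
have ha := scale a (fun i => let: conj _ (And4 _ h _ _) := he i in h).
have hb := scale b (fun i => let: conj _ (And4 _ _ h _) := he i in h).
have hc := scale c (fun i => let: conj _ (And4 _ _ _ h) := he i in h).
have hE : int_bounded sig E X.
  have := scale (fun=> 1) _ 0; rewrite mulr1; apply => i; rewrite mulr1.
  by case: (he i) => _ [].
pose g i := 2 * c i - a i * b i.
have hg i : int_bounded sig (E ^+ 2 * g i) (3 * X ^+ 2).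
  have -> : E ^+ 2 * g i = 2%:~R * (E * (E * c i)) - E * a i * (E * b i).
    by rewrite /g; ring.
  have -> : 3 * X ^+ 2 = `|2|%:~R * (X * X) + X * X by rewrite normr_nat; ring.
  apply: int_boundedB; last exact: int_boundedM.
  by apply: int_boundedM; [apply: int_bounded_int|apply: int_boundedM].
have /(heisenberg_relation_scale _ _ _ _ E0) hk' : heisenberg_relation a b g k.
  exact/(unitri3_prod_eq1 a b c k).
have [k' [k'0 k'b hk'']] := bound X _ _ _ k X1 ha hb hg k0 hk'.
exists k'; split => // [i|].
  apply: le_trans (k'b i) _; rewrite -mulrA ler_pM2l // /X -exprM exprMn.
  by rewrite ler_pM2l ?exprn_gt0 // ler_weXn2l.
apply/(unitri3_prod_eq1 a b c k').
exact/(heisenberg_relation_scale _ _ _ _ E0).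
Qed.
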